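(* Let $C_0,\alpha,c_1>0$ be constants and assume that $(\Lambda_n)_{1\le n\le\mathcal N}$ is monotonically increasing. Then: (i) If $d_n\le C_0n^{-\alpha}$ for every $n\ge1$, then for all $\varphi\in F$ and $1\le n\le\mathcal N$, $$\|\varphi-\mathcal J_n[\varphi]\|_{\mathcal X}\le\begin{cases}2C_0(1+\eta^{-1})(1+\Lambda_1),& n=1,\\ C_0\,2^{3\alpha+1}\,\ell_2\,(1+\Lambda_n)^3\,\eta^{-2}\,n^{-\alpha},& n\ge2,\end{cases}$$ where, writing $n=4\ell+k$ with $\ell\in\{0,1,\dots\}$ and $k\in\{0,1,2,3\}$, $\ell_2=2(\ell+\lceil k/4\rceil)$. (ii) If $C_0\ge1$ and $d_n\le C_0e^{-c_1n^\alpha}$ for every $n\ge1$, then, with $c_2=c_12^{-2\alpha-1}$, for all $\varphi\in F$ and $1\le n\le\mathcal N$, $$\|\varphi-\mathcal J_n[\varphi]\|_{\mathcal X}\le\begin{cases}2C_0(1+\eta^{-1})(1+\Lambda_1),& n=1,\\ C_0\sqrt2\,(1+\Lambda_n)^2\,\eta^{-1}\sqrt n\,e^{-c_2n^\alpha},& n\ge2.\end{cases}$$ (iii) If $d_n\le C_0n^{-\alpha}$ for every $n\ge1$ and $\gamma_n^{-1}\le C_\zeta n^\zeta$ for every $1\le n\le\mathcal N$, with constants $C_\zeta,\zeta>0$, then for any $\beta>1/2$, all $\varphi\in F$ and all $1\le n\le\mathcal N$, $$\|\varphi-\mathcal J_n[\varphi]\|_{\mathcal X}\le\eta\,C_\zeta\,C_1\,n^{-\alpha+2\zeta+\beta},$$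 where $$C_1:=\max\left\{C_0\,2^{\frac{2\alpha^2}{\zeta}}\left(\frac{\zeta+\beta}{\beta-\frac12}\right)^{\alpha}\max\left(1;\,C_\zeta^{\frac{\zeta+\beta}{\zeta}}\right);\ \max_{n=1,\dots,2\lfloor2(\zeta+\beta)\rfloor+1}n^{\alpha-\zeta-\beta}\right\}.$$
   Context: Setting. $\mathcal X$ is a real Banach space of functions defined over a domain $\overline\Omega\subset\mathbb R^d$ or $\mathbb C^d$, with norm $\|\cdot\|_{\mathcal X}$ and dual $\mathcal X'$; $F\subset\mathcal X$ is compact with $\|\varphi\|_{\mathcal X}\le 1$ for all $\varphi\in F$; $\mathcal N\in\{1,2,\dots\}\cup\{\infty\}$ is such that $\dim\operatorname{span}F>\mathcal N$ (infinite-dimensional if $\mathcal N=\infty$); indices $n$ are always finite integers. $\Sigma\subset\mathcal X'$ is a dictionary such that: (P1) $\|\sigma\|_{\mathcal X'}=1$ for all $\sigma\in\Sigma$; (P2) if $\varphi\in\operatorname{span}F$ and $\sigma(\varphi)=0$ for all $\sigma\in\Sigma$, then $\varphi=0$; (P3) for all $\varphi\in\operatorname{span}F$ the set $\{\sigma(\varphi):\sigma\in\Sigma\}\subset\mathbb R$ is closed. GEIM weak greedy algorithm. Fix $\eta\in(0,1]$. Let $F_0\subset F_1\subset\cdots$ be subsets of $F$ and $\widetilde\Sigma_0\subset\widetilde\Sigma_1\subset\cdots$ subsets of $\Sigma$ (all finite if $\eta<1$; $F_n=F$ for all $n$ if $\eta=1$) such that $\widetilde\Sigma_n$ satisfies (P2)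 and (P3) with $F$ replaced by $F_n$. Choose $\varphi_0\in\operatorname{argmax}_{\varphi\in F_0}\|\varphi\|_{\mathcal X}$ and $\sigma_0\in\operatorname{argmax}_{\sigma\in\widetilde\Sigma_0}|\sigma(\varphi_0)|$. For $1\le n\le\mathcal N$ put $X_n=\operatorname{span}\{\varphi_0,\dots,\varphi_{n-1}\}$ and let $\mathcal J_n:\mathcal X\to X_n$ be the linear operator for which $\mathcal J_n[\varphi]$ is the unique element of $X_n$ with $\sigma_i(\mathcal J_n[\varphi])=\sigma_i(\varphi)$, $i=0,\dots,n-1$ (this is well posed and $\dim X_n=n$); then choose $\varphi_n\in\operatorname{argmax}_{\varphi\in F_n}\|\varphi-\mathcal J_n[\varphi]\|_{\mathcal X}$ and $\sigma_n\in\operatorname{argmax}_{\sigma\in\widetilde\Sigma_n}|\sigma(\varphi_n-\mathcal J_n[\varphi_n])|$. The sets $F_n$ are such that $\max_{F_0}\|\varphi\|_{\mathcal X}\ge\eta\max_F\|\varphi\|_{\mathcal X}$ and $\max_{\varphi\in F_n}\|\varphi-\mathcal J_n[\varphi]\|_{\mathcal X}\ge\eta\max_{\varphi\in F}\|\varphi-\mathcal J_n[\varphi]\|_{\mathcal X}$ for $1\le n\le\mathcal N$. Notation. $\Lambda_n=\sup_{\varphi\in\mathcal X\setminus\{0\}}\|\mathcal J_n[\varphi]\|_{\mathcal X}/\|\varphi\|_{\mathcal X}$ (Lebesgue constant) and $\gamma_n=\eta/(1+\Lambda_n)$ for $1\le n\le\mathcal N$. The Kolmogorov $n$-width is $d_n=d_n(F,\mathcal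 X)=\inf_{Y\subset\mathcal X,\ \dim Y\le n}\ \max_{u\in F}\ \inf_{v\in Y}\|u-v\|_{\mathcal X}$ ($Y$ linear subspaces). *)

(* Defs.v *)
From HB Require Import structures.
From mathcomp Require Import all_boot all_order all_algebra.
From mathcomp Require Import all_classical all_reals all_analysis.

Set Implicit Arguments.
Unset Strict Implicit.
Unset Printing Implicit Defensive.

Import Order.TTheory GRing.Theory Num.Theory.
Import numFieldNormedType.Exports.

Local Open Scope classical_set_scope.
Local Open Scope ring_scope.

(* All real-valued sups and infs below are used on nonempty sets that are
   bounded on the relevant side; a [max] of the paper is the (attained) [sup]. *)

Definition lin_span (R : realType) (X : normedModType R) (A : set X) : set X :=
  [set v | exists n (e : 'I_n -> X) (c : 'I_n -> R),
     (forall i, A (e i)) /\ v = \sum_(i < n) c i *: e i].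

Definition linear_subspace (R : realType) (X : normedModType R) (Y : set X) :=
  Y 0 /\ forall (a : R) (u v : X), Y u -> Y v -> Y (a *: u + v).

(* For a linear subspace Y this says dim Y <= n: the n vectors e need be
   neither independent nor in Y. *)
Definition dim_le (R : realType) (X : normedModType R) (Y : set X) (n : nat) :=
  exists e : 'I_n -> X, Y `<=` lin_span (range e).

Definition opnorm (R : realType) (X Y : normedModType R) (f : X -> Y) : R :=
  sup [set `|f u| / `|u| | u in [set u | u != 0]].

Definition kwidth (R : realType) (X : normedModType R) (F : set X) (n : nat)
    : R :=
  inf [set sup [set inf [set `|u - v| | v in Y] | u in F]
      | Y in [set Y : set X | linear_subspace Y /\ dim_le Y n]].

(* [None] stands for N = oo. *)
Definition leN (n : nat) (N : option nat) : bool :=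
  if N is Some m then (n <= m)%N else true.

Definition separating (R : realType) (X : normedModType R)
    (Sigma : set {linear X -> R^o}) (F : set X) :=
  forall u, lin_span F u -> (forall s, Sigma s -> s u = 0) -> u = 0.

Definition closed_values (R : realType) (X : normedModType R)
    (Sigma : set {linear X -> R^o}) (F : set X) :=
  forall u, lin_span F u -> closed [set (s : X -> R^o) u | s in Sigma].

Record geim_setting (R : realType) (X : completeNormedModType R)
    (N : option nat) (F : set X) (Sigma : set {linear X -> R^o}) : Prop := {
  geim_N_ge1 : leN 1 N ;
  geim_compact : compact F ;
  geim_le1 : forall u, F u -> `|u| <= 1 ;
  (* dim (lin_span F) > N *)
  geim_dim : forall n, leN n N -> ~ dim_le (lin_span F) n ;
  geim_dual : forall s, Sigma s -> continuous s ;
  geim_norm1 : forall s, Sigma s -> opnorm s = 1 ;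
  geim_separating : separating Sigma F ;
  geim_closed_values : closed_values Sigma F }.

Definition argmax_on (T : Type) (R : realType) (A : set T) (f : T -> R)
    : set T :=
  [set x | A x /\ forall y, A y -> f y <= f x].

Definition interpolants (R : realType) (X : normedModType R) (phi : nat -> X)
    (sigma : nat -> {linear X -> R^o}) (n : nat) (u : X) : set X :=
  [set v | lin_span [set phi i | i in `I_n] v /\
           forall i, (i < n)%N -> sigma i v = sigma i u].

(* The set of interpolants is a singleton when phi and sigma come from the
   greedy algorithm and [leN n N]; the default value 0 is then irrelevant. *)
Definition geim_op (R : realType) (X : normedModType R) (phi : nat -> X)
    (sigma : nat -> {linear X -> R^o}) (n : nat) (u : X) : X :=
  xget 0 (interpolants phi sigma n u).

Record geim_weak_greedy (R : realType) (X : completeNormedModType R)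
    (N : option nat) (F : set X) (Sigma : set {linear X -> R^o}) (eta : R)
    (Fn : nat -> set X) (Sigman : nat -> set {linear X -> R^o})
    (phi : nat -> X) (sigma : nat -> {linear X -> R^o}) : Prop := {
  geim_eta : 0 < eta <= 1 ;
  geim_Fn_sub : forall n, Fn n `<=` F ;
  geim_Fn_incr : forall n, Fn n `<=` Fn n.+1 ;
  geim_Sigman_sub : forall n, Sigman n `<=` Sigma ;
  geim_Sigman_incr : forall n, Sigman n `<=` Sigman n.+1 ;
  geim_eta_lt1 : eta < 1 ->
    forall n, finite_set (Fn n) /\ finite_set (Sigman n) ;
  geim_eta_eq1 : eta = 1 -> forall n, Fn n = F ;
  geim_Sigman_separating : forall n, separating (Sigman n) (Fn n) ;
  geim_Sigman_closed_values : forall n, closed_values (Sigman n) (Fn n) ;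
  geim_phi0 : argmax_on (Fn 0%N) (fun u => `|u|) (phi 0%N) ;
  geim_sigma0 : argmax_on (Sigman 0%N) (fun s => `|s (phi 0%N)|) (sigma 0%N) ;
  geim_phi : forall n, (1 <= n)%N -> leN n N ->
    argmax_on (Fn n) (fun u => `|u - geim_op phi sigma n u|) (phi n) ;
  geim_sigma : forall n, (1 <= n)%N -> leN n N ->
    argmax_on (Sigman n)
      (fun s => `|s (phi n - geim_op phi sigma n (phi n))|) (sigma n) ;
  geim_weak0 :
    eta * sup [set `|u| | u in F] <= sup [set `|u| | u in Fn 0%N] ;
  geim_weak : forall n, (1 <= n)%N -> leN n N ->
    eta * sup [set `|u - geim_op phi sigma n u| | u in F]
      <= sup [set `|u - geim_op phi sigma n u| | u in Fn n] }.

Definition lebesgue_cst (R : realType) (X : normedModType R) (phi : nat -> X)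
    (sigma : nat -> {linear X -> R^o}) (n : nat) : R :=
  opnorm (geim_op phi sigma n).

Definition geim_gamma (R : realType) (X : normedModType R) (eta : R)
    (phi : nat -> X) (sigma : nat -> {linear X -> R^o}) (n : nat) : R :=
  eta / (1 + lebesgue_cst phi sigma n).

Definition ell2 (R : realType) (n : nat) : R :=
  2 * ((n %/ 4)%:R + (Num.ceil ((n %% 4)%:R / 4 : R))%:~R).

Definition C1_cst (R : realType) (C0 alpha Czeta zeta beta : R) : R :=
  Num.max
    (C0 * 2 `^ (2 * alpha ^+ 2 / zeta)
      * ((zeta + beta) / (beta - 1 / 2)) `^ alpha
      * Num.max 1 (Czeta `^ ((zeta + beta) / zeta)))
    (* a maximum of positive terms over a nonempty range: starting the
       iteration from 0 is harmless *)
    (\big[Num.max/0]_(1 <= n < (2 * Num.truncn (2 * (zeta + beta))%R + 1).+1%N)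
       n%:R `^ (alpha - zeta - beta)).

(* Main.v *)
(* Writing X_n for the span of the first n greedy elements, tau_n for the
   largest distance from F to X_n and gamma_n = eta / (1 + Lambda_n), near
   optimality of the interpolation operator gives an error at most
   (1 + Lambda_n) tau_n and makes the algorithm a weak greedy algorithm:
   gamma_n tau_n <= dist(phi_n, X_n).  Hahn-Banach functionals vanishing on X_j
   and equal to dist(phi_j, X_j) at phi_j turn consecutive phi_i into a
   triangular matrix; its determinant is bounded below by the diagonal entries,
   and above by Hadamard's inequality and AM-GM, as all phi_i are close to one
   m-dimensional space.
   For K = n - p + 1 indices p, ..., n this reads
     (gamma_n tau_n)^(2K) <= (2K)^K tau_p^(2m) d_m^(2(K-m)),
   from which each rate follows by a suitable choice of p and m. *)

Require Import Defs.
From mathcomp Require Import all_boot all_order all_algebra.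
From mathcomp Require Import all_classical all_reals all_analysis.
From mathcomp Require Import ring lra zify.

Set Implicit Arguments.
Unset Strict Implicit.
Unset Printing Implicit Defensive.

Import Order.TTheory GRing.Theory Num.Theory.
Import numFieldNormedType.Exports.

Local Open Scope classical_set_scope.
Local Open Scope ring_scope.

(** * Determinants of approximately low-rank matrices *)

(** The root of order 2K of the estimate reads gamma_n tau_n <= sqrt(2K) tau_p^(m/K) d_m^(1 - m/K).
    The loss sqrt(2K) / gamma_n shapes the three rates. In (ii), p = 1 and tau_1 <= 1, so it is paid
    once: hence sqrt n and a single 1 / gamma_n. In (i), tau_p is bounded by induction; with weights
    1/2 the loss builds up to its square, hence ell_2 and gamma_n^(-2). In (iii), a smaller weight
    on tau_p keeps the accumulated loss below n^(zeta + beta); this weight shrinks to 0 as beta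
    approaches 1/2, the exponent of sqrt(2K) itself. The last factor 1 + Lambda_n, from tau_n to the
    error, is the same everywhere. Monotonicity of Lambda_n lets the single constant gamma_n serve
    for all K indices. The case n = 1 needs a separate argument that is linear in d_1. *)

Lemma sum_sqr_mulmx_orthogonal (R : rcfType) (n K : nat) (A : 'M[R]_(n, K))
    (Q : 'M[R]_K) (i : 'I_n) :
  Q *m Q^T = 1%:M -> \sum_j ((A *m Q) i j) ^+ 2 = \sum_j (A i j) ^+ 2.
Proof.
move=> QQ.
have sumE (B : 'M[R]_(n, K)) : \sum_j (B i j) ^+ 2 = (B *m B^T) i i.
  by rewrite mxE; apply: eq_bigr => j _; rewrite mxE expr2.
by rewrite !sumE trmx_mul mulmxA -(mulmxA A) QQ mulmx1.
Qed.

(* The witness is the reflection exchanging [b] and a multiple of [e_0]. *)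
Lemma householder (R : rcfType) (K : nat) (b : 'rV[R]_K.+1) :
  exists Q : 'M[R]_K.+1, Q *m Q^T = 1%:M /\
    forall j, j != ord0 -> (b *m Q) 0 j = 0.
Proof.
pose s := (b *m b^T) 0 0.
have s_ge0 : 0 <= s.
  by rewrite /s mxE; apply: sumr_ge0 => j _; rewrite mxE -expr2 sqr_ge0.
pose t : 'rV[R]_K.+1 := Num.sqrt s *: delta_mx 0 0.
have tj j : j != ord0 -> t 0 j = 0.
  by move=> j0; rewrite !mxE eqxx (negbTE j0) mulr0.
have scalE (x : 'M[R]_1) : x = (x 0 0)%:M by exact: mx11_scalar.
have tt : (t *m t^T) 0 0 = s.
  rewrite mxE (bigD1 ord0) //= big1 ?addr0.
    by rewrite !mxE !eqxx /= mulr1 -expr2 sqr_sqrtr.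
  by move=> j j0; rewrite [t^T]lock tj ?mul0r.
pose v := b - t.
have [v0|v_neq0] := eqVneq v 0.
  exists 1%:M; rewrite trmx1 mulmx1; split=> // j j0.
  by rewrite mulmx1 (subr0_eq v0) tj.
pose q := (v *m v^T) 0 0.
have q_neq0 : q != 0.
  apply: contraNneq v_neq0 => q0; apply/eqP/rowP => j; rewrite [RHS]mxE.
  move: q0; rewrite /q mxE => /psumr_eq0P q0.
  have /eqP : v 0 j * v^T j 0 = 0.
    by apply: q0 => // i _; rewrite [v^T _ _]mxE -expr2 sqr_ge0.
  by rewrite [v^T _ _]mxE mulf_eq0 orbb => /eqP.
have bt : (b *m t^T) 0 0 = (t *m b^T) 0 0.
  by rewrite -[in LHS](trmxK (b *m t^T)) trmx_mul trmxK mxE.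
(* As [t] and [b] have the same norm, |v|^2 = 2 <b, v>. Hence [b *m P] is [v], and the reflection
   [1%:M - P] takes [b] to [t]. *)
have qE : q = 2 * (b *m v^T) 0 0.
  have vT : v^T = b^T - t^T by rewrite /v linearB.
  have entB (A B : 'M[R]_1) : (A - B) 0 0 = A 0 0 - B 0 0 by rewrite !mxE.
  by rewrite /q vT mulmxBr /v !mulmxBl !mulmxBr !entB tt -bt -/s; ring.
pose P := (2 / q) *: (v^T *m v).
have PT : P^T = P by rewrite /P linearZ /= trmx_mul trmxK.
have PP : P *m P = P + P.
  rewrite /P -scalemxAl -scalemxAr -(mulmxA v^T) (mulmxA v) (scalE (v *m v^T)).
  rewrite -/q mul_scalar_mx -scalemxAr !scalerA -scalerDl; congr (_ *: _).
  by field.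
exists (1%:M - P); split.
  have -> : (1%:M - P)^T = 1%:M - P by rewrite raddfB /= trmx1 PT.
  rewrite mulmxBl mul1mx mulmxBr mulmx1 PP opprB addrK.
  by rewrite subrK.
move=> j j0; rewrite mulmxBr mulmx1 /P -scalemxAr mulmxA (scalE (b *m v^T)).
rewrite mul_scalar_mx scalerA.
have -> : 2 / q * (b *m v^T) 0 0 = 1 by move: q_neq0; rewrite qE mulf_eq0 negb_or => /andP[_ ?]; field.
by rewrite scale1r /v opprB addrCA subrr addr0 tj.
Qed.

(** A reflection clears the first row beyond its first entry, and induction treats the lower right
    block. The rectangular case is the one used for low rank: all columns of [B *m Q] from index [m]
    on vanish. *)
Lemma lq_decomposition (R : rcfType) (m K : nat) (B : 'M[R]_(m, K)) :
  exists Q : 'M[R]_K, Q *m Q^T = 1%:M /\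
    forall (i : 'I_m) (j : 'I_K), (i < j)%N -> (B *m Q) i j = 0.
Proof.
elim: K m B => [|K IH] m B.
  by exists 1%:M; rewrite trmx1 mulmx1; split=> // i [].
case: m B => [|m] B.
  by exists 1%:M; rewrite trmx1 mulmx1; split=> // -[].
have [Q1 [Q1o Q1b]] := householder (row ord0 B).
pose B1 : 'M[R]_(1 + m, 1 + K) := B *m Q1.
have [Q2 [Q2o Q2B]] := IH m (drsubmx B1).
pose Q3 : 'M[R]_(1 + K) := block_mx 1%:M 0 0 Q2.
have Q3o : Q3 *m Q3^T = 1%:M.
  rewrite /Q3 tr_block_mx mulmx_block !trmx1 !trmx0 !mulmx0 !mul0mx !mulmx1.
  by rewrite Q2o !addr0 add0r -scalar_mx_block.
exists (Q1 *m Q3); split.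
  by rewrite trmx_mul mulmxA -(mulmxA Q1) Q3o mulmx1.
have B1E : B *m (Q1 *m Q3) = block_mx (ulsubmx B1) 0
    (dlsubmx B1) (drsubmx B1 *m Q2).
  rewrite mulmxA; transitivity (B1 *m Q3); first by [].
  rewrite -[X in X *m _ = _](submxK B1) /Q3.
  rewrite (@mulmx_block _ 1 m 1 K 1 K) !mulmx0 !mulmx1 ?addr0 ?add0r.
  suff -> : ursubmx B1 = 0 by rewrite mul0mx.
  apply/matrixP => i j; have := Q1b (rshift 1 j) isT.
  rewrite -row_mul !mxE => Q1b0; rewrite -[RHS]Q1b0 ord1.
  by apply: eq_bigr => k _; congr (B _ _ * _); apply: val_inj.
move=> i j; rewrite B1E.
have [i' ->|i' ->] := split_ordP (i : 'I_(1 + m));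
  have [j' ->|j' ->] := split_ordP (j : 'I_(1 + K)).
- by rewrite !ord1.
- by move=> _; rewrite (@block_mxEur _ 1 m 1 K) mxE.
- by rewrite ord1.
- by rewrite (@block_mxEdr _ 1 m 1 K) /= ltn_add2l => /Q2B.
Qed.

Lemma det_orthogonal_sqr (R : rcfType) (K : nat) (Q : 'M[R]_K) :
  Q *m Q^T = 1%:M -> (\det Q) ^+ 2 = 1.
Proof. by move=> /(congr1 determinant); rewrite det_mulmx det_tr det1 expr2. Qed.

(** An orthogonal [Q] changes neither the squared determinant nor the row norms, and can make [H]
    triangular; each diagonal entry is then at most the norm of its row. *)
Lemma hadamard (R : rcfType) (K : nat) (H : 'M[R]_K) :
  (\det H) ^+ 2 <= \prod_i \sum_j (H i j) ^+ 2.
Proof.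
have [Q [Qo Qt]] := lq_decomposition H.
have -> : (\det H) ^+ 2 = (\det (H *m Q)) ^+ 2.
  by rewrite det_mulmx exprMn (det_orthogonal_sqr Qo) mulr1.
rewrite det_trig; last first.
  by apply/is_trig_mxP.
rewrite -prodrXl; apply: ler_prod => i _; rewrite sqr_ge0 /=.
rewrite -(sum_sqr_mulmx_orthogonal H i Qo) (bigD1 i) //= lerDl.
by apply: sumr_ge0 => j _; rewrite sqr_ge0.
Qed.

(* In a basis adapted to the row space of [L], the last [r] columns of [G]
   are those of [V]; Hadamard's inequality on columns and AM-GM conclude. *)
Lemma det_sqr_low_rank_approx (R : rcfType) (m r : nat) (G V : 'M[R]_(m + r))
    (C : 'M[R]_(m + r, m)) (L : 'M[R]_(m, m + r)) (t d : R) :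
  0 < t -> 0 < d -> G = C *m L + V ->
  (forall i j, `|G i j| <= t) -> (forall i j, `|V i j| <= d) ->
  (\det G) ^+ 2
    <= (2 * (m + r)%:R) ^+ (m + r) * t ^+ (2 * m) * d ^+ (2 * r).
Proof.
move=> t0 d0 GE Gt Vd; set K := (m + r)%N.
have [K0|K0] := posnP K.
  rewrite (_ : \det G = 1); last first.
    by move: K0 G {GE Gt}; rewrite /K => -> G; rewrite det_mx00.
  move/eqP: K0; rewrite addn_eq0 => /andP[/eqP m0 /eqP r0].
  by rewrite /K m0 r0 !muln0 !expr0 !mulr1 expr1n.
have [Q [Qo Qt]] := lq_decomposition L.
have -> : (\det G) ^+ 2 = (\det (G *m Q)^T) ^+ 2.
  by rewrite det_tr det_mulmx exprMn (det_orthogonal_sqr Qo) mulr1.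
apply: le_trans (hadamard _) _.
have KR : 0 < K%:R :> R by rewrite ltr0n.
pose c (A : 'M[R]_K) j := \sum_i ((A *m Q) i j) ^+ 2.
have c_ge0 A j : 0 <= c A j by apply: sumr_ge0 => i _; rewrite sqr_ge0.
have cB (A : 'M[R]_K) (a : R) : 0 < a -> (forall i j, `|A i j| <= a) ->
    \sum_j c A j <= K%:R * (K%:R * a ^+ 2).
  move=> a0 Aa; rewrite exchange_big /=.
  under eq_bigr => i _ do rewrite (sum_sqr_mulmx_orthogonal A i Qo).
  have -> : K%:R * (K%:R * a ^+ 2) = \sum_(i < K) \sum_(j < K) a ^+ 2.
    by rewrite sumr_const card_ord sumr_const card_ord 2!mulr_natl.
  apply: ler_sum => i _.
  apply: ler_sum => j _.
  by rewrite -real_normK ?num_real // ler_sqr ?nnegrE ?normr_ge0 ?(ltW a0).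
have cV j : c G (rshift m j) = c V (rshift m j).
  apply: eq_bigr => i _; rewrite GE mulmxDl mxE -mulmxA.
  rewrite [X in X + _]mxE big1 ?add0r // => k _.
  by rewrite Qt ?mulr0 //= ltn_addr.
pose w (a : R) := K%:R * a ^+ 2.
have w_gt0 (a : R) : 0 < a -> 0 < w a by move=> a0; rewrite mulr_gt0 // exprn_gt0.
(* Rescaling keeps the sizes [t] and [d] apart in AM-GM: each of the two groups of columns adds at
   most [K] to the sum of [x], so the product of [x] is at most [2 ^ K], while the weights
   contribute [K ^ K]. *)
pose x j := c G j / w (if fintype.split j is inl _ then t else d).
have x_ge0 j : 0 <= x j.
  by rewrite divr_ge0 // ltW // w_gt0 //; case: fintype.split.
have prodE : \prod_(i < K) \sum_(j < K) ((G *m Q)^T i j) ^+ 2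
    = (\prod_j x j) * (K%:R ^+ K * t ^+ (2 * m) * d ^+ (2 * r)).
  transitivity (\prod_j (x j * w (if fintype.split j is inl _ then t else d))).
    apply: eq_bigr => j _; rewrite divfK.
      by apply: eq_bigr => i _; rewrite mxE.
    by rewrite gt_eqF // w_gt0 //; case: fintype.split.
  rewrite big_split /= [X in _ * X]big_split_ord /=; congr (_ * _).
  under eq_bigr => j _ do rewrite (unsplitK (inl j)).
  under [X in _ * X]eq_bigr => j _ do rewrite (unsplitK (inr j)).
  rewrite !prodr_const !card_ord /w !(mulnC 2%N) !exprM !exprMn exprD.
  by rewrite !expr2; ring.
have sumx : \sum_j x j <= 2 * K%:R.
  rewrite big_split_ord /= mulr_natl mulr2n; apply: lerD.
    rewrite /x; under eq_bigr => j _ do rewrite (unsplitK (inl j)).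
    rewrite -mulr_suml ler_pdivrMr ?w_gt0 //; apply: le_trans (cB G t t0 Gt).
    by rewrite big_split_ord /= lerDl sumr_ge0.
  rewrite /x; under eq_bigr => j _ do rewrite (unsplitK (inr j)) cV.
  rewrite -mulr_suml ler_pdivrMr ?w_gt0 //; apply: le_trans (cB V d d0 Vd).
  by rewrite big_split_ord /= lerDr sumr_ge0.
rewrite prodE exprMn -!mulrA; apply: ler_wpM2r.
  by rewrite !mulr_ge0 ?exprn_ge0 ?ltW.
have [AG _] := leif_AGM (A := 'I_K) (E := x) (fun j _ => x_ge0 j).
apply: le_trans AG _; rewrite card_ord lerXn2r ?nnegrE ?ler0n //.
  by rewrite divr_ge0 ?sumr_ge0.
by rewrite ler_pdivrMr.
Qed.

(** * Hahn-Banach functionals measuring a distance *)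

Definition dist_to (R : realType) (X : normedModType R) (u : X) (S : set X)
    : R :=
  inf [set `|u - v| | v in S].

Lemma dist_to_le (R : realType) (X : normedModType R) (S : set X) (u v : X) :
  S v -> dist_to u S <= `|u - v|.
Proof.
move=> Sv; apply: ge_inf; last by exists v.
by exists 0 => _ [w _ <-].
Qed.

Lemma le_dist_to (R : realType) (X : normedModType R) (S : set X) (u : X)
    (a : R) :
  S !=set0 -> (forall v, S v -> a <= `|u - v|) -> a <= dist_to u S.
Proof.
move=> [v Sv] Sa; apply: lb_le_inf; first by exists `|u - v|, v.
by move=> _ [w Sw <-]; apply: Sa.
Qed.

Lemma dist_to_adherent (R : realType) (X : normedModType R) (S : set X)
    (u : X) (a : R) :
  S !=set0 -> dist_to u S < a -> exists2 v, S v & `|u - v| < a.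
Proof.
move=> S0; rewrite ltNge => /negP Sa.
apply: contrapT => noV; apply: Sa; apply: le_dist_to => // v Sv.
by rewrite leNgt; apply/negP => uv; apply: noV; exists v.
Qed.

Section Subspace.
Variables (R : realType) (X : normedModType R).
Implicit Types (S A : set X) (u v w : X).

Lemma subspaceD S u v : linear_subspace S -> S u -> S v -> S (u + v).
Proof. by move=> [_ Sl] Su Sv; rewrite -[u]scale1r; apply: Sl. Qed.

Lemma subspaceZ S (a : R) u : linear_subspace S -> S u -> S (a *: u).
Proof. by move=> [S0 Sl] Su; rewrite -[_ *: _]addr0; apply: Sl. Qed.

Lemma subspaceB S u v : linear_subspace S -> S u -> S v -> S (u - v).
Proof.
by move=> Sl Su Sv; rewrite -scaleN1r; apply: subspaceD => //; apply: subspaceZ.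
Qed.

Lemma subspace_sum S n (e : 'I_n -> X) (c : 'I_n -> R) :
  linear_subspace S -> (forall i, S (e i)) -> S (\sum_(i < n) c i *: e i).
Proof.
move=> Sl Se; elim/big_ind: _ => [|u v|i _]; first by case: Sl.
  exact: subspaceD.
exact: subspaceZ.
Qed.

Lemma lin_span_subspace A : linear_subspace (lin_span A).
Proof.
split.
  by exists 0%N, (fun=> 0), (fun=> 0); split; [case|rewrite big_ord0].
move=> a _ _ [n [e [c [Ae ->]]]] [m [f [d [Af ->]]]].
exists (n + m)%N, (fun i => match fintype.split i with inl j => e j | inr j => f j end),
  (fun i => match fintype.split i with inl j => a * c j | inr j => d j end).
split; first by move=> i; case: fintype.split.
rewrite big_split_ord /= scaler_sumr; congr (_ + _); apply: eq_bigr => i _.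
  by rewrite (unsplitK (inl i)) scalerA.
by rewrite (unsplitK (inr i)).
Qed.

Lemma sub_lin_span A : A `<=` lin_span A.
Proof.
move=> u Au; exists 1%N, (fun=> u), (fun=> 1); split => //.
by rewrite big_ord1 scale1r.
Qed.

Lemma lin_span_min S A : linear_subspace S -> A `<=` S -> lin_span A `<=` S.
Proof.
move=> Sl AS _ [n [e [c [Ae ->]]]]; apply: subspace_sum => // i.
exact/AS/Ae.
Qed.

Lemma lin_spanS A B : A `<=` B -> lin_span A `<=` lin_span B.
Proof.
move=> AB; apply: lin_span_min; first exact: lin_span_subspace.
by move=> u /AB; apply: sub_lin_span.
Qed.

Lemma lin_span_rangeP n (e : 'I_n -> X) u :
  lin_span (range e) u -> exists c : 'I_n -> R, u = \sum_(i < n) c i *: e i.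
Proof.
apply: (@lin_span_min [set u | exists c : 'I_n -> R, u = \sum_i c i *: e i]).
  split=> [|a _ _ [c ->] [d ->]].
    by exists (fun=> 0); rewrite big1 // => i _; rewrite scale0r.
  exists (fun i => a * c i + d i); rewrite scaler_sumr -big_split /=.
  by apply: eq_bigr => i _; rewrite scalerDl scalerA.
move=> _ [k _ <-]; exists (fun i => (i == k)%:R).
rewrite (bigD1 k) //= eqxx scale1r big1 ?addr0 // => i /negbTE->.
by rewrite scale0r.
Qed.

(** A total function stands for a functional with domain [S]; its values elsewhere are free, so
    extending it means giving another pair. On a subspace the one-sided bound already yields the
    bound on absolute values. *)
Definition dominated_linear S (l : X -> R) :=
  (forall (a : R) u v, S u -> S v -> l (a *: u + v) = a * l u + l v) /\
  (forall u, S u -> l u <= `|u|).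

Lemma dominated_linear_sum S l n (e : 'I_n -> X) (c : 'I_n -> R) :
  linear_subspace S -> dominated_linear S l -> (forall i, S (e i)) ->
  l (\sum_(i < n) c i *: e i) = \sum_(i < n) c i * l (e i).
Proof.
move=> Sl [ll _] Se; elim: n e c Se => [|n IH] e c Se.
  rewrite !big_ord0; have S0 : S 0 by case: Sl.
  by have := ll 1 0 0 S0 S0; rewrite scaler0 addr0 mul1r => /eqP; rewrite -subr_eq subrr eq_sym => /eqP.
rewrite !big_ord_recl ll //; first by rewrite IH.
exact: subspace_sum.
Qed.

Lemma dominated_linearB S l u v : linear_subspace S -> dominated_linear S l ->
  S u -> S v -> l (u - v) = l u - l v.
Proof.
move=> Sl [ll _] Su Sv; rewrite addrC -scaleN1r ll // mulN1r addrC //.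
Qed.

Lemma dominated_linear_norm S l u : linear_subspace S ->
  dominated_linear S l -> S u -> `|l u| <= `|u|.
Proof.
move=> Sl [ll ln] Su; rewrite ler_norml ln // andbT lerNl.
have S0 : S 0 by case: Sl.
have := ll (-1) u 0 Su S0; have := dominated_linearB Sl (conj ll ln) S0 S0.
rewrite subrr subrr => ->; rewrite !addr0 scaleN1r mulN1r => <-.
by rewrite -normrN; apply: ln; rewrite -scaleN1r; apply: subspaceZ.
Qed.

(* One-step extension: every value [r] at [w] squeezed between the two bounds
   below is admissible. *)
Lemma dominated_linear_extend S l w (r : R) :
  linear_subspace S -> dominated_linear S l -> ~ S w ->
  (forall u, S u -> l u - `|u - w| <= r <= `|u + w| - l u) ->
  exists S' l', [/\ linear_subspace S', dominated_linear S' l', S `<=` S',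
    (forall u, S u -> l' u = l u) & S' w /\ l' w = r].
Proof.
move=> Sl ldom nSw rb; have [ll ln] := ldom.
have S0 : S 0 by case: Sl.
have l0 : l 0 = 0 by have := dominated_linearB Sl ldom S0 S0; rewrite !subrr.
pose dec x := [set p : X * R | S p.1 /\ x = p.1 + p.2 *: w].
(* The decomposition is unique because [w] is outside [S]; the default [(0, 0)] only concerns
   vectors outside the new domain. *)
pose l' x := let p := xget (0, 0) (dec x) in l p.1 + p.2 * r.
have decU u v a b : S u -> S v -> u + a *: w = v + b *: w -> a = b.
  move=> Su Sv uv; apply: contrapT => /eqP; rewrite eq_sym -subr_eq0 => ab.
  apply: nSw; have -> : w = (b - a)^-1 *: (u - v).
    have -> : u - v = (b - a) *: w.
      have -> : u = v + b *: w - a *: w by rewrite -uv addrK.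
      by rewrite scalerBl addrAC [v + _]addrC addrK.
    by rewrite scalerA mulVf // scale1r.
  by apply: subspaceZ => //; apply: subspaceB.
have l'E u c : S u -> l' (u + c *: w) = l u + c * r.
  move=> Su; rewrite /l'; case: xgetP => [[v b] _ [/= Sv uv]|/(_ (u, c))]; last by case.
  have cb := decU _ _ _ _ Su Sv uv; rewrite -cb in uv *.
  by rewrite (addIr _ uv).
exists [set x | exists u c, S u /\ x = u + c *: w], l'; split.
- split; first by exists 0, 0; rewrite scale0r addr0.
  move=> a _ _ [u [c [Su ->]]] [v [d [Sv ->]]].
  exists (a *: u + v), (a * c + d); split; first by case: Sl => _; apply.
  by rewrite scalerDr scalerDl scalerA addrACA.
- split=> [a _ _ [u [c [Su ->]]] [v [d [Sv ->]]]|_ [u [c [Su ->]]]].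
    have -> : a *: (u + c *: w) + (v + d *: w) = (a *: u + v) + (a * c + d) *: w.
      by rewrite scalerDr scalerDl scalerA addrACA.
    rewrite !l'E //; last by case: Sl => _; apply.
    by rewrite ll //; ring.
  rewrite l'E //; have [c0|c0|->] := ltgtP c 0; last first.
  + by rewrite mul0r scale0r !addr0 ln.
  + have /andP[_] := rb (c^-1 *: u) (subspaceZ _ Sl Su).
    have -> : `|c^-1 *: u + w| = c^-1 * `|u + c *: w|.
      rewrite -[X in X * _]gtr0_norm ?invr_gt0 // -normrZ scalerDr scalerA.
      by rewrite mulVf ?gt_eqF // scale1r.
    have := ll c^-1 u 0 Su S0; rewrite l0 !addr0 => ->.
    by rewrite -mulrBr -(ler_pM2l c0) mulVKf ?gt_eqF // lerBrDl.
  + have nc0 : 0 < - c by rewrite oppr_gt0.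
    have /andP[+ _] := rb ((- c)^-1 *: u) (subspaceZ _ Sl Su).
    have -> : `|(- c)^-1 *: u - w| = (- c)^-1 * `|u + c *: w|.
      rewrite -[X in X * _]gtr0_norm ?invr_gt0 // -normrZ scalerDr scalerA.
      by rewrite invrN mulNr mulVf ?lt_eqF // scaleN1r.
    have := ll (- c)^-1 u 0 Su S0; rewrite l0 !addr0 => ->.
    rewrite -mulrBr -(ler_pM2l nc0) mulVKf ?gt_eqF // mulNr.
    by rewrite lerBlDr -lerBlDl opprK.
- by move=> u Su; exists u, 0; rewrite scale0r addr0.
- move=> u Su.
  by rewrite -[u]addr0 -(scale0r w) l'E // mul0r scale0r !addr0.
- split; first by exists 0, 1; rewrite scale1r add0r.
  by rewrite -[w]scale1r -[X in l' X]add0r l'E // l0 add0r mul1r.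
Qed.

(** By the triangle inequality every lower bound for the value at [w] is below every upper bound;
    the supremum of the lower bounds is chosen. *)
Lemma dominated_linear_extend1 S l w :
  linear_subspace S -> dominated_linear S l ->
  exists S' l', [/\ linear_subspace S', dominated_linear S' l', S `<=` S',
    (forall u, S u -> l' u = l u) & S' w].
Proof.
move=> Sl ldom; have [Sw|nSw] := pselect (S w); first by exists S, l; split.
pose A := [set l u - `|u - w| | u in S].
have S0 : S 0 by case: Sl.
have Aub u v : S u -> S v -> l v - `|v - w| <= `|u + w| - l u.
  move=> Su Sv; have [ll ln] := ldom.
  have := ln _ (subspaceD Sl Su Sv).
  rewrite -[X in l (X + v)]scale1r ll // mul1r => luv.
  have := ler_normD (u + w) (v - w); rewrite addrACA subrr addr0; lra.
have [|S' [l' [? ? ? ? [? _]]]] := dominated_linear_extend (r := sup A) Sl ldom nSw.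
  move=> u Su; apply/andP; split.
    apply: ub_le_sup; last by exists u.
    by exists (`|u + w| - l u) => _ [v Sv <-]; apply: Aub.
  apply: ge_sup; first by exists (l u - `|u - w|), u.
  by move=> _ [v Sv <-]; apply: Aub.
by exists S', l'.
Qed.

(** A determinant evaluates its functionals at finitely many vectors only, so finitely many one-step
    extensions replace the maximality argument of Hahn-Banach. *)
Lemma dominated_linear_extend_seq S l (ws : seq X) :
  linear_subspace S -> dominated_linear S l ->
  exists S' l', [/\ linear_subspace S', dominated_linear S' l', S `<=` S',
    (forall u, S u -> l' u = l u) & forall w, w \in ws -> S' w].
Proof.
elim: ws S l => [|w ws IH] S l Sl ldom; first by exists S, l; split.
have [S1 [l1 [S1l l1dom SS1 l1l S1w]]] := dominated_linear_extend1 w Sl ldom.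
have [S2 [l2 [S2l l2dom S12 l2l S2w]]] := IH _ _ S1l l1dom.
exists S2, l2; split=> //.
- exact: subset_trans S12.
- by move=> u Su; rewrite l2l ?l1l //; exact: SS1.
- by move=> v; rewrite inE => /predU1P[->|/S2w//]; apply: S12.
Qed.

(** The zero functional on [S] admits at [w] any nonnegative value up to the infimum of |u + w| over
    [u] in [S]. This infimum is the distance from [w] to [S], and is the value taken. *)
Lemma dist_functional S w (ws : seq X) : linear_subspace S ->
  exists S' l, [/\ linear_subspace S', dominated_linear S' l,
    S `<=` S' /\ (forall u, S u -> l u = 0),
    S' w /\ l w = dist_to w S & forall v, v \in ws -> S' v].
Proof.
move=> Sl; have S0 : S 0 by case: Sl.
have zdom : dominated_linear S (fun=> 0).
  by split=> [a u v _ _|u _]; rewrite ?mulr0 ?addr0.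
suff [S1 [l1 [S1l l1dom SS1 l1S [S1w l1w]]]] : exists S' l',
    [/\ linear_subspace S', dominated_linear S' l', S `<=` S',
      (forall u, S u -> l' u = 0) & S' w /\ l' w = dist_to w S].
  have [S2 [l2 [S2l l2dom S12 l2l S2w]]] :=
    dominated_linear_extend_seq ws S1l l1dom.
  exists S2, l2; split=> //.
  - split; first exact: subset_trans S12.
    by move=> u Su; rewrite l2l ?l1S //; exact: SS1.
  - by split; [exact: S12|rewrite l2l].
have d0 : 0 <= dist_to w S by apply: le_dist_to => //; exists 0.
have [Sw|nSw] := pselect (S w).
  exists S, (fun=> 0); split=> //; split=> //.
  by apply/eqP; rewrite eq_le d0 (le_trans (dist_to_le w Sw)) ?subrr ?normr0.
have [|S' [l' [? ? ? ? [? ?]]]] :=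
    dominated_linear_extend (r := dist_to w S) Sl zdom nSw; last by exists S', l'.
move=> u Su; rewrite subr0 sub0r (le_trans _ d0) ?oppr_le0 //=.
have Su' : S (- u) by rewrite -scaleN1r; apply: subspaceZ.
by rewrite addrC -[u in leRHS]opprK; exact: dist_to_le.
Qed.

End Subspace.

(** * The weak greedy estimate *)

Section Widths.
Variables (R : realType) (X : normedModType R).
Implicit Types (F : set X) (phi : nat -> X).

(** A functional that vanishes on a subspace is bounded by the distance to it, so all entries are at
    most [t]. Approximating each vector in the span of the [m] vectors [e] splits the matrix into
    [C *m L], of rank at most [m], and an error [E] bounded by [d]. *)
Lemma greedy_determinant phi (p m r : nat) (a t d : R) (e : 'I_m -> X) :
  0 <= a -> 0 < t -> 0 < d ->
  let V n := lin_span [set phi i | i in `I_n] in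
  (forall i, (i < m + r)%N -> a <= dist_to (phi (p + i)%N) (V (p + i)%N)) ->
  (forall i j, (i < m + r)%N -> (j < m + r)%N ->
     dist_to (phi (p + i)%N) (V (p + j)%N) <= t) ->
  (forall i, (i < m + r)%N ->
     exists2 y, lin_span (range e) y & `|phi (p + i)%N - y| <= d) ->
  a ^+ (2 * (m + r))
    <= (2 * (m + r)%:R) ^+ (m + r) * t ^+ (2 * m) * d ^+ (2 * r).
Proof.
move=> a0 t0 d0 V lo up app; set K := (m + r)%N.
(* These are all the vectors that must lie in the domains of the functionals. *)
pose ws := [seq phi i | i <- iota 0 (p + K)] ++ [seq e k | k <- enum 'I_m].
have Vsub j : linear_subspace (V j) by exact: lin_span_subspace.
have /choice[S /choice[l lP]] (j : 'I_K) :=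
  dist_functional (phi (p + j)%N) ws (Vsub (p + j)%N).
have /choice[c cP] (i : 'I_K) : exists c : 'I_m -> R,
    `|phi (p + i)%N - \sum_k c k *: e k| <= d.
  have [y /lin_span_rangeP[c ->] yd] := app i (ltn_ord i).
  by exists c.
have Sphi j (i : 'I_K) : S j (phi (p + i)%N).
  have [_ _ _ _] := lP j; apply; rewrite mem_cat map_f //.
  by rewrite mem_iota ltn_add2l ltn_ord.
have Se j k : S j (e k).
  by have [_ _ _ _] := lP j; apply; rewrite mem_cat (map_f e) ?orbT ?mem_enum.
have Ssum j (c' : 'I_m -> R) : S j (\sum_k c' k *: e k).
  by have [Sj _ _ _ _] := lP j; apply: subspace_sum.
pose G : 'M[R]_K := \matrix_(i, j) l j (phi (p + i)%N).
pose C : 'M[R]_(K, m) := \matrix_(i, k) c i k.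
pose L : 'M[R]_(m, K) := \matrix_(k, j) l j (e k).
pose E : 'M[R]_K := \matrix_(i, j) l j (phi (p + i)%N - \sum_k c i k *: e k).
have GE : G = C *m L + E.
  apply/matrixP => i j; have [Sj lj _ _ _] := lP j; rewrite !mxE.
  rewrite (dominated_linearB Sj lj) // (dominated_linear_sum _ Sj lj) //.
  rewrite [X in X + _](eq_bigr (fun k => c i k * l j (e k))) ?subrKC //.
  by move=> k _; rewrite !mxE.
have Gt i j : `|G i j| <= t.
  rewrite mxE; apply: le_trans (up i j (ltn_ord i) (ltn_ord j)).
  have [Sj lj [VS l0] _ _] := lP j.
  apply: le_dist_to; first by exists 0; case: (Vsub (p + j)%N).
  move=> v Vv; rewrite -[l j _]subr0 -(l0 v Vv) -(dominated_linearB Sj lj) //.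
    by apply: dominated_linear_norm lj _ => //; apply: subspaceB => //; apply: VS.
  exact: VS.
have Ed i j : `|E i j| <= d.
  rewrite mxE; apply: le_trans (cP i); have [Sj lj _ _ _] := lP j.
  by apply: dominated_linear_norm lj _ => //; apply: subspaceB.
apply: le_trans (det_sqr_low_rank_approx t0 d0 GE Gt Ed).
rewrite det_trig; last first.
  apply/is_trig_mxP => i j ij; rewrite mxE; have [_ _ [_ l0] _ _] := lP j.
  by apply: l0; apply: sub_lin_span; exists (p + i)%N; rewrite //= ltn_add2l.
rewrite mulnC exprM ler_sqr ?nnegrE ?exprn_ge0 //; last first.
  apply: prodr_ge0 => i _; rewrite mxE; have [_ _ _ [_ ->] _] := lP i.
  exact: le_trans (lo i (ltn_ord i)).
have -> : a ^+ K = \prod_(i < K) a by rewrite prodr_const card_ord.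
apply: ler_prod => i _; rewrite a0 mxE; have [_ _ _ [_ ->] _] := lP i.
exact: lo.
Qed.

Lemma bounded_dist_to_sup F (Y : set X) u : (forall v, F v -> `|v| <= 1) ->
  Y 0 -> F u -> dist_to u Y <= sup [set dist_to v Y | v in F].
Proof.
move=> F1 Y0 Fu; apply: ub_le_sup; last by exists u.
exists 1 => _ [v Fv <-]; apply: le_trans (F1 v Fv).
by rewrite -[v in leRHS]subr0; apply: dist_to_le.
Qed.

Lemma kwidth_approx F m (d : R) : (forall v, F v -> `|v| <= 1) ->
  kwidth F m < d ->
  exists e : 'I_m -> X, forall u, F u ->
    exists2 y, lin_span (range e) y & `|u - y| < d.
Proof.
move=> F1 /inf_lt[|_ [Y [Yl [e Ye]] <-] Yd].
  exists (sup [set inf [set `|u - v| | v in [set 0]] | u in F]), [set 0] => //.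
  split; last first.
    by exists (fun=> 0) => _ ->; have [] := lin_span_subspace (range ((fun=> 0) : 'I_m -> X)).
  by split=> [//|a _ _ -> ->]; rewrite /= scaler0 addr0.
exists e => u Fu; have Y0 : Y 0 by case: Yl.
have /dist_to_adherent[|y Yy yd] := le_lt_trans (bounded_dist_to_sup F1 Y0 Fu) Yd.
  by exists 0.
by exists y => //; apply: Ye.
Qed.

(** The width is an infimum that may not be attained: approximating spaces exist only for [d] above
    [D], and the bound at [D] is recovered as a limit. *)
Lemma ler_of_gt_exp (x c D : R) k : (forall d, D < d -> x <= c * d ^+ k) ->
  x <= c * D ^+ k.
Proof.
move=> h; apply: (@cvgr_to_ge _ D^'+ _ _ (fun d => c * d ^+ k)).

  apply: cvg_at_right_filter; apply: cvgMl_tmp.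
  exact: exprn_continuous.
by near=> d; apply: h; near: d; exact: nbhs_right_gt.
Unshelve. all: by end_near. Qed.

Definition greedy_width F phi n : R :=
  sup [set dist_to u (lin_span [set phi i | i in `I_n]) | u in F].

Section Bounded.
Variables (F : set X) (phi : nat -> X).
Hypothesis F1 : forall v, F v -> `|v| <= 1.
Hypothesis F0 : F !=set0.
Let V n := lin_span [set phi i | i in `I_n].

Let V0 n : V n 0. Proof. by case: (lin_span_subspace [set phi i | i in `I_n]). Qed.

Lemma greedy_width_ge n u : F u -> dist_to u (V n) <= greedy_width F phi n.
Proof. by move=> Fu; apply: bounded_dist_to_sup. Qed.

Lemma greedy_width_le n (a : R) : (forall u, F u -> dist_to u (V n) <= a) ->
  greedy_width F phi n <= a.
Proof.
move=> Fa; apply: ge_sup; last by move=> _ [u Fu <-]; apply: Fa.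
by have [u Fu] := F0; exists (dist_to u (V n)), u.
Qed.

Lemma greedy_width_le1 n : greedy_width F phi n <= 1.
Proof.
apply: greedy_width_le => u Fu; apply: le_trans (F1 Fu).
by rewrite -[u in leRHS]subr0; apply: dist_to_le.
Qed.

Lemma greedy_width_ge0 n : 0 <= greedy_width F phi n.
Proof.
have [u Fu] := F0; apply: le_trans (greedy_width_ge n Fu).
by apply: le_dist_to => //; exists 0.
Qed.

Lemma greedy_width_nincr p n : (p <= n)%N ->
  greedy_width F phi n <= greedy_width F phi p.
Proof.
move=> pn; apply: greedy_width_le => u Fu; apply: le_trans (greedy_width_ge p Fu).
apply: le_dist_to; first by exists 0.
move=> v Vv; apply: dist_to_le; apply: lin_spanS Vv => _ [i /= ip <-].
by exists i => //=; apply: leq_trans ip pn.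
Qed.

(** As [greedy_width] is nonincreasing in the index, its value at [n], times [g], is below every
    diagonal entry, and its value at [p] is above every entry. *)
Lemma weak_greedy_estimate (p m r n : nat) (g D : R) :
  (0 < m + r)%N -> (p + (m + r) = n.+1)%N -> 0 <= g -> 0 < D ->
  kwidth F m <= D ->
  (forall i, (p <= i <= n)%N -> F (phi i)) ->
  (forall i, (p <= i <= n)%N ->
     g * greedy_width F phi i <= dist_to (phi i) (V i)) ->
  (g * greedy_width F phi n) ^+ (2 * (m + r))
    <= (2 * (m + r)%:R) ^+ (m + r) * greedy_width F phi p ^+ (2 * m)
       * D ^+ (2 * r).
Proof.
move=> K0 pn g0 D0 FD Fphi weak; set t := greedy_width F phi p.
set a := g * _.
have a0 : 0 <= a by rewrite mulr_ge0 ?greedy_width_ge0.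
have range i : (i < m + r)%N -> (p <= p + i <= n)%N by lia.
have lo i : (i < m + r)%N -> a <= dist_to (phi (p + i)%N) (V (p + i)%N).
  move=> iK; apply: le_trans (weak _ (range i iK)).
  by apply: ler_wpM2l => //; apply: greedy_width_nincr; lia.
have up i j : (i < m + r)%N -> (j < m + r)%N ->
    dist_to (phi (p + i)%N) (V (p + j)%N) <= t.
  move=> iK jK; apply: le_trans (greedy_width_ge _ (Fphi _ (range i iK))) _.
  by apply: greedy_width_nincr; rewrite leq_addr.
(* The determinant bound requires a positive [t]; otherwise [a], squeezed between 0 and [t], is
   0. *)
have [t0|t0] := leP t 0.
  have -> : a = 0.
    apply/eqP; rewrite eq_le a0 andbT (le_trans _ t0) //.
    exact: le_trans (lo 0%N K0) (up 0%N 0%N K0 K0).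
  rewrite expr0n muln_eq0 /= eqn0Ngt K0 /= !mulr_ge0 ?exprn_ge0 ?(ltW D0) //.
  by rewrite greedy_width_ge0.
apply: ler_of_gt_exp => d Dd.
have [e eP] := kwidth_approx F1 (le_lt_trans FD Dd).
apply: (greedy_determinant (e := e) _ _ _ lo up) => //; first exact: lt_trans Dd.
by move=> i iK; have [y ? /ltW ?] := eP _ (Fphi _ (range i iK)); exists y.
Qed.

End Bounded.
End Widths.

(** * Interpolation operators *)

(** The determinant estimate with p = 0 and m = r = 1 would only give the square root of the width.
    Instead, [u] and [phi 0] are both compared with one line, spanned by [e ord0]: if they are close
    to [a *: e ord0] and [b *: e ord0], then [u] is close to [(a / b) *: phi 0]. *)
Lemma greedy_width1_le (R : realType) (X : normedModType R) (F : set X)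
    (phi : nat -> X) (eta D : R) :
  (forall u, F u -> `|u| <= 1) -> F (phi 0%N) -> 0 < eta ->
  (forall u, F u -> eta * `|u| <= `|phi 0%N|) -> 0 < D -> kwidth F 1 <= D ->
  greedy_width F phi 1 <= 2 * (1 + eta^-1) * D.
Proof.
move=> F1 F0 eta0 Feta D0 FD.
rewrite -[leRHS]/(2 * (1 + eta^-1) * D ^+ 1); apply: ler_of_gt_exp => d Dd.
rewrite expr1; have d0 := lt_trans D0 Dd.
have [e eP] := kwidth_approx F1 (le_lt_trans FD Dd).
have lin1 u : F u -> exists a, `|u - a *: e ord0| < d.
  by move=> /eP[_ /lin_span_rangeP[c ->]]; rewrite big_ord1; exists (c ord0).
set V := lin_span [set phi i | i in `I_1].
have Vl : linear_subspace V by exact: lin_span_subspace.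
have Vphi a : V (a *: phi 0%N).
  by apply: subspaceZ => //; apply: sub_lin_span; exists 0%N.
have ei0 : 0 < eta^-1 by rewrite invr_gt0.
apply: greedy_width_le => [|u Fu]; first by exists (phi 0%N).
set t := `|phi 0%N|.
have ut : `|u| <= t * eta^-1 by rewrite ler_pdivlMr // mulrC; apply: Feta.
(* A short [phi 0] forces all of [F] to be small, and 0 approximates well enough. Otherwise
   [b *: e ord0] has more than half the norm of [phi 0], which controls [a / b]. *)
have [td|td] := leP t (2 * d).
  apply: le_trans (dist_to_le _ (Vphi 0)) _.
  rewrite scale0r subr0; apply: le_trans ut _; nra.
have [a ua] := lin1 u Fu; have [b ub] := lin1 _ F0.
have b0 : b != 0.
  by apply: contraTneq ub => ->; rewrite scale0r subr0 -leNgt -/t; lra.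
apply: le_trans (dist_to_le _ (Vphi (a / b))) _.
set y := a *: e ord0 in ua; set y0 := b *: e ord0 in ub.
have yE : y = (a / b) *: y0 by rewrite scalerA divfK.
have yn : `|a / b| * `|y0| <= t * eta^-1 + d.
  rewrite -normrZ -yE -[y](subrKC u); apply: le_trans (ler_normD _ _) _.
  by apply: lerD => //; rewrite distrC ltW.
have y0n : t - d <= `|y0|.
  have := ler_normD (phi 0%N - y0) y0; rewrite subrK -/t; lra.
have lam : `|a / b| <= 1 + 2 * eta^-1.
  rewrite leNgt; apply/negP => lt; have : (1 + 2 * eta^-1) * (t - d) <= t * eta^-1 + d.
    apply: le_trans yn; apply: ler_pM; rewrite ?(ltW lt) //; [nra|lra].
  nra.
have -> : u - (a / b) *: phi 0%N = (u - y) - (a / b) *: (phi 0%N - y0).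
  by rewrite scalerBr -yE opprB addrA subrK.
apply: le_trans (ler_normB _ _) _; rewrite normrZ.
have : `|a / b| * `|phi 0%N - y0| <= (1 + 2 * eta^-1) * d.
  by apply: ler_pM => //; apply: ltW.
move: (ltW ua); lra.
Qed.

Section Newton.
Variables (R : realType) (X : normedModType R).
Variables (phi : nat -> X) (sigma : nat -> {linear X -> R^o}).
Let V n := lin_span [set phi i | i in `I_n].

(** Newton form of interpolation: the correction direction [r] is annihilated by the earlier
    functionals, so earlier conditions survive. Division by 0 being 0, the operator is total and
    linear even before the pivots are known to be nonzero. *)
Fixpoint newton_op n (u : X) : X :=
  if n is k.+1 then
    let r := phi k - newton_op k (phi k) in
    newton_op k u + (sigma k (u - newton_op k u) / sigma k r) *: r
  else 0.

Lemma newton_op_linear n (a : R) u v :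
  newton_op n (a *: u + v) = a *: newton_op n u + newton_op n v.
Proof.
elim: n => [|n IH] /=; first by rewrite scaler0 addr0.
rewrite IH; set r := phi n - _; set c := sigma n r.
have -> : a *: u + v - (a *: newton_op n u + newton_op n v) =
    a *: (u - newton_op n u) + (v - newton_op n v).
  by rewrite scalerBr opprD addrACA.
rewrite linearP /= -[_ *: sigma n _]/(_ * _) mulrDl scalerDl.
by rewrite [a *: (newton_op n u + _)]scalerDr scalerA mulrA addrACA.
Qed.

Lemma newton_opB n u v : newton_op n (u - v) = newton_op n u - newton_op n v.
Proof. by rewrite addrC -scaleN1r newton_op_linear scaleN1r addrC. Qed.

Lemma newton_op_span n u : V n (newton_op n u).
Proof.
have Vl k : linear_subspace (V k) by exact: lin_span_subspace.
have VS k : V k `<=` V k.+1.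
  by apply: lin_spanS => _ [i /= ik <-]; exists i => //=; apply: ltnW.
elim: n u => [|n IH] u /=; first by case: (Vl 0%N).
apply: subspaceD => //; first exact: VS.
apply: subspaceZ => //; apply: subspaceB => //; last exact: VS.
by apply: sub_lin_span; exists n => /=.
Qed.

Lemma newton_op0 n u : (forall i, (i < n)%N -> sigma i u = 0) ->
  newton_op n u = 0.
Proof.
elim: n => //= n IH su; rewrite IH => [|i ni]; last by apply: su; apply: ltnW.
by rewrite subr0 su // mul0r scale0r addr0.
Qed.

(** Some finite [M] is all that is wanted: it makes the [sup] in the Lebesgue constant a genuine
    supremum instead of the default 0. *)
Lemma newton_op_bounded n :
  (forall i u, (i < n)%N -> `|sigma i u| <= `|u|) ->
  exists2 M : R, 0 <= M & forall u, `|newton_op n u| <= M * `|u|.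
Proof.
elim: n => [|n IH] s1; first by exists 0 => // u; rewrite normr0 mul0r.
have [|M M0 MP] := IH; first by move=> i u ni; apply: s1; apply: ltnW.
pose r := phi n - newton_op n (phi n).
pose b := `|(sigma n r)^-1| * `|r|.
exists (M + (1 + M) * b) => [|u]; first by rewrite addr_ge0 ?mulr_ge0 ?addr_ge0.
rewrite /= -/r; apply: le_trans (ler_normD _ _) _; rewrite mulrDl.
apply: lerD => //; rewrite normrZ normrM -[leLHS]mulrA -/b [leRHS]mulrAC.
apply: ler_wpM2r; first by rewrite mulr_ge0.
apply: le_trans (s1 _ _ (ltnSn n)) _; apply: le_trans (ler_normB _ _) _.
by rewrite mulrDl mul1r lerD2l.
Qed.

Variable n : nat.
Hypothesis pivot : forall i, (i < n)%N ->
  sigma i (phi i - newton_op i (phi i)) != 0.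

Lemma newton_op_interpolates u i : (i < n)%N ->
  sigma i (newton_op n u) = sigma i u.
Proof.
have aux k : (k <= n)%N -> forall i u, (i < k)%N ->
    sigma i (newton_op k u) = sigma i u.
  elim: k => // k IH kn j v; rewrite ltnS leq_eqVlt => /predU1P[->|jk] /=.
    rewrite linearD linearZ /= -[_ *: _]/(_ * _) divfK ?pivot // linearB /=.
    by rewrite subrKC.
  rewrite linearD linearZ /= [sigma j (_ - _)]linearB /= !IH ?(ltnW kn) // subrr.
  by rewrite scaler0 addr0.
exact: aux.
Qed.

Lemma newton_op_id v : V n v -> newton_op n v = v.
Proof.
have aux k : (k <= n)%N -> forall i, (i < k)%N -> newton_op k (phi i) = phi i.
  elim: k => // k IH kn j; rewrite ltnS leq_eqVlt => /predU1P[->|jk] /=.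
    by rewrite divff ?pivot // scale1r subrKC.
  by rewrite IH ?(ltnW kn) // subrr linear0 mul0r scale0r addr0.
apply: (@lin_span_min _ _ [set v | newton_op n v = v]).
  split; first by rewrite /= -[0 in LHS](subrr 0) newton_opB subrr.
  by move=> a u w /= un wn; rewrite newton_op_linear un wn.
by move=> _ [i /= ni <-]; apply: aux.
Qed.

(** Uniqueness of interpolants: the difference of two lies in the span, where [newton_op] is the
    identity, and is annihilated by the functionals, so that [newton_op] sends it to 0. *)
Lemma geim_op_newton u : geim_op phi sigma n u = newton_op n u.
Proof.
rewrite /geim_op; case: xgetP => [v _ [Vv sv]|/(_ (newton_op n u))]; last first.
  by case; split; [exact: newton_op_span|exact: newton_op_interpolates].
rewrite -(newton_op_id Vv) -[LHS](subrK (newton_op n u)) -newton_opB.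
rewrite newton_op0 ?add0r // => i ni.
by rewrite linearB /= sv // subrr.
Qed.

Lemma newton_op_residual_dist (M : R) u : 0 <= M ->
  (forall v, `|newton_op n v| <= M * `|v|) ->
  `|u - newton_op n u| <= (1 + M) * dist_to u (V n).
Proof.
move=> M0 MP; rewrite -ler_pdivrMl ?ltr_pwDl //; apply: le_dist_to.
  by exists 0; case: (lin_span_subspace [set phi i | i in `I_n]).
move=> v Vv; rewrite ler_pdivrMl ?ltr_pwDl //.
have -> : u - newton_op n u = (u - v) - newton_op n (u - v).
  by rewrite newton_opB (newton_op_id Vv) opprB addrA subrK.
apply: le_trans (ler_normB _ _) _; rewrite mulrDl mul1r lerD2l.
exact: MP.
Qed.

End Newton.

(** * The greedy algorithm *)

Lemma leN_trans m n N : (m <= n)%N -> leN n N -> leN m N.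
Proof. by case: N => //= N; apply: leq_trans. Qed.

Lemma opnorm_ge0 (R : realType) (X Y : normedModType R) (f : X -> Y) :
  0 <= opnorm f.
Proof.
rewrite /opnorm; set A := [set _ | _ in _].
have [[[x Ax] Aub]|nA] := pselect (has_sup A); last by rewrite sup_out.
apply: le_trans (ub_le_sup Aub Ax); case: Ax => u _ <-.
by rewrite divr_ge0.
Qed.

Lemma opnorm_le (R : realType) (X Y : normedModType R) (f : X -> Y) (M : R) :
  f 0 = 0 -> (forall u, `|f u| <= M * `|u|) ->
  forall u, `|f u| <= opnorm f * `|u|.
Proof.
move=> f0 fM u; have [->|u0] := eqVneq u 0; first by rewrite f0 !normr0 mulr0.
rewrite -ler_pdivrMr ?normr_gt0 //; apply: ub_le_sup; last by exists u.
by exists M => _ [v v0 <-]; rewrite ler_pdivrMr ?normr_gt0.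
Qed.

(** A set without supremum has [sup] equal to 0, so the value 1 certifies that the quotients are
    bounded. *)
Lemma opnorm1_le (R : realType) (X Y : normedModType R) (f : {linear X -> Y}) :
  opnorm f = 1 -> forall u, `|f u| <= `|u|.
Proof.
move=> f1 u; have [->|u0] := eqVneq u 0; first by rewrite linear0 normr0.
rewrite -[leRHS]mul1r -ler_pdivrMr ?normr_gt0 // -f1.
rewrite /opnorm in f1 *; set A := [set _ | _ in _] in f1 *.
have [hA|nA] := pselect (has_sup A).
  by apply: ub_le_sup; [case: hA|exists u].
by move/eqP: f1; rewrite sup_out // eq_sym oner_eq0.
Qed.

Section Geim.
Variables (R : realType) (X : completeNormedModType R).
Variables (N : option nat) (F : set X) (Sigma : set {linear X -> R^o}) (eta : R).
Variables (Fn : nat -> set X) (Sigman : nat -> set {linear X -> R^o}).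
Variables (phi : nat -> X) (sigma : nat -> {linear X -> R^o}).
Hypothesis hset : geim_setting N F Sigma.
Hypothesis hgreedy : geim_weak_greedy N F Sigma eta Fn Sigman phi sigma.
Let V n := lin_span [set phi i | i in `I_n].
Let eta_gt0 : 0 < eta. Proof. by case/andP: (geim_eta hgreedy). Qed.

Lemma geim_phi_Fn n : leN n N -> Fn n (phi n).
Proof.
case: n => [|n] nN; first by case: (geim_phi0 hgreedy).
by case: (geim_phi hgreedy (ltn0Sn n) nN).
Qed.

Lemma geim_phi_F n : leN n N -> F (phi n).
Proof. by move=> /geim_phi_Fn; apply: (geim_Fn_sub hgreedy). Qed.

Lemma geim_sigma_Sigman n : leN n N -> Sigman n (sigma n).
Proof.
case: n => [|n] nN; first by case: (geim_sigma0 hgreedy).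
by case: (geim_sigma hgreedy (ltn0Sn n) nN).
Qed.

Lemma geim_sigma_le n u : leN n N -> `|sigma n u| <= `|u|.
Proof.
move=> nN; apply: opnorm1_le; apply: (geim_norm1 hset).
exact/(geim_Sigman_sub hgreedy)/geim_sigma_Sigman.
Qed.

Lemma geim_newton_bounded n : leN n N ->
  exists2 M : R, 0 <= M & forall u, `|newton_op phi sigma n u| <= M * `|u|.
Proof.
move=> nN; apply: newton_op_bounded => i u /ltnW ni.
by apply: geim_sigma_le; apply: leN_trans nN.
Qed.

Definition geim_pivots n := forall i, (i < n)%N ->
  sigma i (phi i - newton_op phi sigma i (phi i)) != 0.

Lemma geim_weak_residual n u : leN n N -> geim_pivots n -> F u ->
  eta * `|u - newton_op phi sigma n u|
    <= `|phi n - newton_op phi sigma n (phi n)|.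
Proof.
move=> nN piv Fu; set err := fun u => `|u - newton_op phi sigma n u|.
have [phin weak] : argmax_on (Fn n) err (phi n) /\
    eta * sup [set err v | v in F] <= sup [set err v | v in Fn n].
  case: n nN piv @err => [|n] nN piv err.
    have -> : err = fun v => `|v| by apply/funext => v; rewrite /err /= subr0.
    by split; [exact: geim_phi0 hgreedy|exact: geim_weak0 hgreedy].
  have -> : err = fun v => `|v - geim_op phi sigma n.+1 v|.
    by apply/funext => v; rewrite /err (geim_op_newton piv).
  split; first exact: (geim_phi hgreedy (ltn0Sn n) nN).
  exact: (geim_weak hgreedy (ltn0Sn n) nN).
case: phin => Fphin phin.
apply: (@le_trans _ _ (eta * sup [set err v | v in F])).
  apply: ler_wpM2l; first exact: ltW.
  apply: ub_le_sup; last by exists u.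
  have [M M0 MP] := geim_newton_bounded nN.
  exists (1 + M) => _ [v Fv <-]; apply: le_trans (ler_normB _ _) _.
  have v1 := geim_le1 hset Fv; apply: lerD => //; apply: le_trans (MP v) _.
  by rewrite ler_piMr.
apply: le_trans weak _; apply: ge_sup; first by exists (err (phi n)), (phi n).
by move=> _ [v Fv <-]; apply: phin.
Qed.

(** If the maximal functional vanishes on the residual of [phi k], so does all of [Sigman k], and
    the residual is 0 by separation. The weak greedy condition then makes every residual of [F]
    vanish, so [F] lies in a span of [k] vectors, against [geim_dim]. The induction supplies the
    earlier pivots, which identify [geim_op] with [newton_op]. *)
Lemma geim_pivotsP n : leN n N -> geim_pivots n.+1.
Proof.
have pivS k : leN k N -> geim_pivots k -> geim_pivots k.+1.
  move=> kN piv i; rewrite ltnS leq_eqVlt => /predU1P[->{i}|/piv//].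
  apply/negP => /eqP sk0.
  have [_ smax] : argmax_on (Sigman k)
      (fun s => `|s (phi k - newton_op phi sigma k (phi k))|) (sigma k).
    case: k kN piv {sk0} => [|k] kN piv.
      by rewrite /= subr0; exact: geim_sigma0 hgreedy.
    rewrite -(geim_op_newton piv); exact: (geim_sigma hgreedy (ltn0Sn k) kN).
  have sig0 s : Sigman k s -> s (phi k - newton_op phi sigma k (phi k)) = 0.
    by move=> /smax; rewrite sk0 normr0 normr_le0 => /eqP.
  have r0 : phi k - newton_op phi sigma k (phi k) = 0.
    apply: (geim_Sigman_separating hgreedy (n := k)) sig0.
    have Fnk := lin_span_subspace (Fn k).
    apply: subspaceB => //; first exact/sub_lin_span/geim_phi_Fn.
    apply: lin_spanS (newton_op_span phi sigma k _) => _ [i /= ik <-].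
    have FnS j : (i <= j)%N -> Fn i `<=` Fn j.
      elim: j => [|j IH]; first by rewrite leqn0 => /eqP->.
      rewrite leq_eqVlt => /predU1P[->//|/IH ij].
      exact: subset_trans ij (geim_Fn_incr hgreedy (n := j)).
    apply: (FnS k (ltnW ik)); apply: geim_phi_Fn; exact: leN_trans (ltnW ik) kN.
  apply: (geim_dim hset kN); exists (fun i : 'I_k => phi i).
  apply: lin_span_min; first exact: lin_span_subspace.
  move=> u Fu; have := geim_weak_residual kN piv Fu.
  rewrite r0 normr0 pmulr_rle0 // normr_le0 subr_eq0 => /eqP ->.
  apply: lin_spanS (newton_op_span phi sigma k _) => _ [i /= ik <-].
  by exists (Ordinal ik).
elim: n => [|n IH] nN; first exact: pivS.
by apply: (pivS) => //; apply: IH; apply: leN_trans nN.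
Qed.

Lemma geim_pivotsW n : leN n N -> geim_pivots n.
Proof. by move=> /geim_pivotsP piv i /ltnW; apply: piv. Qed.

Lemma geim_lebesgue_ge0 n : 0 <= lebesgue_cst phi sigma n.
Proof. exact: opnorm_ge0. Qed.

Lemma geim_error_le_dist n u : leN n N ->
  `|u - geim_op phi sigma n u|
    <= (1 + lebesgue_cst phi sigma n) * dist_to u (V n).
Proof.
move=> nN; have piv := geim_pivotsW nN; rewrite /lebesgue_cst.
have -> : geim_op phi sigma n = newton_op phi sigma n.
  by apply/funext => v; apply: geim_op_newton.
apply: newton_op_residual_dist => //; first exact: opnorm_ge0.
have [M M0 MP] := geim_newton_bounded nN.
by apply: opnorm_le MP; apply: newton_op0 => i _; rewrite linear0.
Qed.

Lemma geim_error_le n u : leN n N -> F u ->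
  `|u - geim_op phi sigma n u|
    <= (1 + lebesgue_cst phi sigma n) * greedy_width F phi n.
Proof.
move=> nN Fu; apply: le_trans (geim_error_le_dist _ nN) _.
apply: ler_wpM2l; first by rewrite addr_ge0 ?geim_lebesgue_ge0.
by apply: greedy_width_ge => // v; apply: (geim_le1 hset).
Qed.

(** The algorithm compares residuals, not distances. For [u] in [F] the residual is at least the
    distance; for [phi n] it exceeds the distance at most by the factor 1 + Lambda_n. *)
Lemma geim_phi_weak_greedy n : leN n N ->
  geim_gamma eta phi sigma n * greedy_width F phi n <= dist_to (phi n) (V n).
Proof.
move=> nN; have L0 := geim_lebesgue_ge0 n.
have L1 : 0 < 1 + lebesgue_cst phi sigma n by rewrite ltr_pwDl.
rewrite /geim_gamma mulrAC ler_pdivrMr // -ler_pdivlMl //.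
apply: greedy_width_le => [|u Fu]; first by exists (phi n); apply: geim_phi_F.
rewrite ler_pdivlMl // mulrC -[leRHS]mulrC.
have res := geim_weak_residual nN (geim_pivotsW nN) Fu.
have := geim_error_le_dist (phi n) nN.
rewrite (geim_op_newton (geim_pivotsW nN)) => /(le_trans res); apply: le_trans.
rewrite mulrC; apply: ler_wpM2l; first exact: ltW.
exact/dist_to_le/newton_op_span.
Qed.

Lemma geim_phi0_weak u : F u -> eta * `|u| <= `|phi 0%N|.
Proof.
have N0 : leN 0 N by apply: (leN_trans _ (geim_N_ge1 hset)).
by move=> Fu; have := geim_weak_residual N0 (geim_pivotsW N0) Fu; rewrite /= !subr0.
Qed.

Lemma geim_F_neq0 : F !=set0.
Proof.
by exists (phi 0%N); apply: geim_phi_F; apply: (leN_trans _ (geim_N_ge1 hset)).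
Qed.

End Geim.

(** * Convergence rates *)

Lemma ell2E (R : realType) n : ell2 R n = 2 * ((n + 3) %/ 4)%:R.
Proof.
have cE : Num.ceil ((n %% 4)%:R / 4 : R) = (0 < n %% 4)%N%:Z.
  apply: ceil_def; have : (n %% 4 < 4)%N by rewrite ltn_mod.
  by case: (n %% 4)%N => [|[|[|[|]]]] //= _; lra.
rewrite /ell2 cE; congr (_ * _); rewrite -[X in X%:~R]/(Posz _) -pmulrn -natrD.
congr (_%:R); lia.
Qed.

(** The ideal values m = n/4 and p = n/2 satisfy n^2 = 8pm; this 8 is the origin of 2^(3 alpha) in
    the rate. *)
Lemma ceil4_split n : (1 < n)%N ->
  let m := ((n + 3) %/ 4)%N in let p := (n - 2 * m + 1)%N in
  [/\ (0 < m)%N, (0 < p)%N, (p < n)%N, (p + (m + m) = n.+1)%N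
    & (n * n <= p * m * 8)%N].
Proof.
move=> n1 m p.
have [j j3 nj] : exists2 j, (j <= 3)%N & (n + j = 4 * m)%N.
  by exists (4 * m - n)%N; rewrite /m; lia.
have pj : (p + j = 2 * m + 1)%N by rewrite /p; lia.
(* With n = 4m - j and p = 2m + 1 - j, the difference 8pm - n^2 is 8m - j^2. *)
clearbody m p; have [m1|m2] := leqP m 1%N; first by split; nia.
by split; try lia; case: j j3 nj pj => [|[|[|[|]]]] // _ nj pj; nia.
Qed.

Lemma half_split n : (1 < n)%N -> let m := n./2 in
  [/\ (0 < m)%N, (m + (n - m) = n)%N, (n <= 2 * (n - m))%N & (n <= 4 * m)%N].
Proof. by move=> n1 m; rewrite /m; split; lia. Qed.

Lemma powRN_le (R : realType) (x y a : R) : 0 <= a -> 0 < x -> x <= y ->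
  y `^ (- a) <= x `^ (- a).
Proof.
move=> a0 x0 xy; have y0 := lt_le_trans x0 xy.
rewrite !powRN lef_pV2 ?posrE ?powR_gt0 //.
by apply: (ge0_ler_powR a0); rewrite ?nnegrE ?(ltW x0) ?(ltW y0).
Qed.

(** This explains c_2: squaring the target bound doubles the exponent, and twice c_2 n^alpha is c_1
    (n/4)^alpha. *)
Lemma powR2_quarter (R : realType) (a : R) :
  2 `^ (- (2 * a) - 1) *+ 2 = 4^-1 `^ a.
Proof.
have two : (2 : R) != 0 by rewrite pnatr_eq0.
have half : (2^-1 : R) *+ 2 = 1 by rewrite mulr2n; lra.
rewrite powRD ?two ?implybT // powR_inv1 // -mulrnAr half mulr1.
by rewrite -mulNr powRrM powRN powR_mulrn // -natrX.
Qed.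

(* The inductive step of [tau_refined] after taking logarithms: [c0], [c1],
   [g], [t], [tp], [lnd] stand for the logarithms of [C0], [C1], [gam n],
   [tau n], [tau p] and [(beta - 1 / 2) / theta]. *)
Lemma log_rate_step (R : realType) (K m r alpha zeta beta theta ln2 lnn lnCz
    lnK lnm lnp lnd c0 c1 g t tp : R) :
  0 <= m -> 0 < r -> K = m + r -> 0 < zeta -> 1 / 2 < beta ->
  theta = zeta + beta -> theta < alpha -> K * (zeta + 1 / 2) <= r * theta ->
  0 <= ln2 -> 0 <= lnn -> 0 <= lnCz ->
  lnK <= lnn -> lnn - ln2 <= lnp -> lnd + lnn - 2 * ln2 <= lnm ->
  c0 + 2 * alpha ^+ 2 / zeta * ln2 - alpha * lnd + theta / zeta * lnCz <= c1 ->
  - lnCz - zeta * lnn <= g -> tp <= c1 + (theta - alpha) * lnp ->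
  2 * K * (g + t)
    <= K * (ln2 + lnK) + 2 * m * tp + 2 * r * (c0 - alpha * lnm) ->
  t <= c1 + (theta - alpha) * lnn.
Proof.
move=> m0 r0 KE z0 b12 thE tha Kr l2 ln0 lC hK hp hm hc1 hg htp est.
have K0 : 0 < K by rewrite KE ltr_wpDl.
have a0 : 0 < alpha by lra.
suff : 2 * K * t <= 2 * K * (c1 + (theta - alpha) * lnn).
  by rewrite ler_pM2l // mulr_gt0.
have est1 : 2 * K * t <= K * (ln2 + lnn) + 2 * m * (c1 + (theta - alpha) * lnp)
    + 2 * r * (c0 - alpha * lnm) + 2 * K * (lnCz + zeta * lnn).
  have h1 : 2 * K * (- lnCz - zeta * lnn) <= 2 * K * g by rewrite ler_pM2l ?mulr_gt0.
  have h2 : 2 * m * tp <= 2 * m * (c1 + (theta - alpha) * lnp).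
    by apply: ler_wpM2l => //; rewrite mulr_ge0.
  have h3 : K * (ln2 + lnK) <= K * (ln2 + lnn) by rewrite ler_pM2l // lerD2l.
  lra.
have estp : 2 * m * ((theta - alpha) * lnp)
    <= 2 * m * ((theta - alpha) * (lnn - ln2)).
  apply: ler_wpM2l; first by rewrite mulr_ge0.
  by apply: ler_wnM2l => //; lra.
have estm : 2 * r * (alpha * (lnd + lnn - 2 * ln2)) <= 2 * r * (alpha * lnm).
  by rewrite ler_pM2l ?mulr_gt0 // ler_pM2l.
have estc1 : 2 * r * (c0 + 2 * alpha ^+ 2 / zeta * ln2 - alpha * lnd
    + theta / zeta * lnCz) <= 2 * r * c1 by rewrite ler_pM2l ?mulr_gt0.
(* The induction leaves only the power r/K of C1 to absorb constants. As K/r is at most theta/zeta,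
   the power theta/zeta of Cz inside C1 is enough. *)
have rz : K <= r * (theta / zeta) by rewrite mulrA ler_pdivlMr //; lra.
have eC : 2 * K * lnCz <= 2 * r * (theta / zeta * lnCz).
  have h1 : K * lnCz <= r * (theta / zeta) * lnCz by apply: ler_wpM2r.
  lra.
have en : (K + 2 * K * zeta) * lnn <= 2 * r * theta * lnn.
  by apply: ler_wpM2r => //; lra.
(* All lost factors 2 meet here: from 2K, from p >= n/2 and from m >= d n/4. They determine the
   power of 2 in C1. *)
have e2 : (K + 2 * m * (alpha - theta) + 4 * r * alpha) * ln2
    <= 2 * r * (2 * alpha ^+ 2 / zeta) * ln2.
  apply: ler_wpM2r => //.
  have mK : m * (alpha - theta) <= K * (alpha - theta).
    by apply: ler_wpM2r; lra.
  have raz : K <= r * (alpha / zeta).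
    apply: le_trans rz _; rewrite ler_pM2l // ler_pM2r ?invr_gt0 //; exact: ltW.
  have h1 : K * (alpha - zeta) <= r * (alpha / zeta) * (alpha - zeta).
    by apply: ler_wpM2r; lra.
  have h3 : r * (alpha / zeta) * (alpha - zeta) =
      r * (alpha ^+ 2 / zeta) - r * alpha.
    by field; rewrite gt_eqF.
  have h2 : K * (1 / 2) <= K * beta by rewrite ler_pM2l // ltW.
  have h4 : 0 <= K * (alpha - zeta) by rewrite mulr_ge0 ?(ltW K0) //; lra.
  rewrite thE in mK *.
  lra.
rewrite KE in est1 eC en e2 *.
lra.
Qed.

(** When no index is left for m, n <= 2/d, so n^alpha is absorbed by the powers of 1/d and 2 in C1;
    [t] is bounded by the logarithm of 4 C0 Cz. *)
Lemma log_rate_base (R : realType) (alpha zeta beta theta ln2 lnn lnCz lnd c0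
    c1 t : R) :
  0 < zeta -> 1 / 2 < beta -> theta = zeta + beta -> theta < alpha ->
  0 <= ln2 -> 0 <= lnn -> 0 <= lnCz -> lnd + lnn - ln2 <= 0 ->
  c0 + 2 * alpha ^+ 2 / zeta * ln2 - alpha * lnd + theta / zeta * lnCz <= c1 ->
  t <= 2 * ln2 + c0 + lnCz ->
  t <= c1 + (theta - alpha) * lnn.
Proof.
move=> z0 b12 thE tha l2 ln0 lC hd hc1 ht.
have a0 : 0 < alpha by lra.
have h1 : alpha * (lnn - ln2) <= alpha * (- lnd) by rewrite ler_pM2l //; lra.
have h2 : lnCz <= theta / zeta * lnCz.
  by apply: ler_peMl => //; rewrite ler_pdivlMr //; lra.
have h3 : 0 <= theta * lnn by rewrite mulr_ge0 //; lra.
(* Since alpha > zeta + 1/2, alpha^2 is at least alpha zeta and at least (zeta + 1/2)^2 >= 2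
   zeta. *)
have h4 : 2 + alpha <= 2 * alpha ^+ 2 / zeta.
  rewrite ler_pdivlMr // expr2.
  have az : (zeta + 1 / 2) * alpha <= alpha * alpha by rewrite ler_pM2r //; lra.
  have az2 : (zeta + 1 / 2) * (zeta + 1 / 2) <= (zeta + 1 / 2) * alpha.
    by rewrite ler_pM2l; lra.
  have := sqr_ge0 (zeta - 1 / 2); rewrite expr2; lra.
have h5 : (2 + alpha) * ln2 <= 2 * alpha ^+ 2 / zeta * ln2 by apply: ler_wpM2r.
lra.
Qed.

Lemma uphalf_split n : (1 < n)%N -> let p := uphalf n in let K := n./2.+1 in
  [/\ (0 < p)%N, (p < n)%N, (p + K = n.+1)%N, (K <= n)%N &
    [/\ (0 < K)%N, (n <= 2 * K)%N & (n <= 2 * p)%N]].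
Proof. by move=> n1 p K; rewrite /p /K; split=> [|||| ]; [lia..|split; lia]. Qed.

(** * Rates for abstract sequences satisfying the determinant estimate *)

Section Rates.
Variables (R : realType) (tau gam kw : nat -> R) (eta : R) (good : pred nat).
Hypothesis eta01 : 0 < eta <= 1.
Hypothesis good_le : forall m n, (m <= n)%N -> good n -> good m.
Hypothesis tau_ge0 : forall n, 0 <= tau n.
Hypothesis tau_le1 : forall n, tau n <= 1.
Hypothesis tau_nincr : forall m n, (m <= n)%N -> tau n <= tau m.
Hypothesis tau1 : forall D : R, 0 < D -> kw 1%N <= D -> tau 1%N <= 2 * (1 + eta^-1) * D.
Hypothesis gam_gt0 : forall n, 0 < gam n.
Hypothesis gam_le : forall n, gam n <= eta.
Hypothesis gam_nincr : forall m n, (0 < m)%N -> (m <= n)%N -> good n ->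
  gam n <= gam m.
Hypothesis estimate : forall (p m r n : nat) (D : R),
  (0 < p)%N -> (0 < m + r)%N -> (p + (m + r) = n.+1)%N -> good n ->
  0 < D -> kw m <= D ->
  (gam n * tau n) ^+ (2 * (m + r))
    <= (2 * (m + r)%:R) ^+ (m + r) * tau p ^+ (2 * m) * D ^+ (2 * r).

Variables (C0 alpha : R).
Hypotheses (C0_gt0 : 0 < C0) (alpha_gt0 : 0 < alpha).

Section Polynomial.
Hypothesis kw_le : forall n, (0 < n)%N -> kw n <= C0 * n%:R `^ (- alpha).

Lemma tau1_polynomial : tau 1%N <= 2 * (1 + eta^-1) * C0.
Proof.
by apply: tau1 => //; have := kw_le (ltn0Sn 0); rewrite mulr1n powR1 mulr1.
Qed.

(* The estimate with [m = r = ceil(n/4)] bounds the square of [tau n] by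
   [tau (n - 2m + 1)] times the width [kw m]. *)
Lemma tau_polynomial n : (0 < n)%N -> good n ->
  tau n <= C0 * 2 `^ (3 * alpha + 1) * (2 * ((n + 3) %/ 4)%:R)
    * gam n ^- 2 * n%:R `^ (- alpha).
Proof.
have [eta0 eta1] := andP eta01.
have pow2 : 2 `^ (3 * alpha + 1) = 2 * 8 `^ alpha :> R.
  rewrite powRD ?pnatr_eq0 ?implybT // powRr1 // mulrC powRrM -[3]/(3%:R).
  by rewrite powR_mulrn //; congr (_ * _ `^ _); rewrite -natrX.
rewrite pow2; set A := 8 `^ alpha; have A_gt0 : 0 < A by exact: powR_gt0.
have A_ge1 : 1 <= A.
  by have := ler_powR (ler1n R 8) (ltW alpha_gt0); rewrite powRr0.
elim/ltn_ind: n => n IH n0 gn.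
(* The recursion can reach [p = 1], so the general formula must hold there too. *)
have g0 := gam_gt0 n; have [n1|n1] := leqP n 1%N.
  have -> : n = 1%N by lia.
  have g1 : gam 1%N <= 1 := le_trans (gam_le _) eta1.
  rewrite -[((1 + 3) %/ 4)%N]/1%N powR1 !mulr1.
  apply: le_trans tau1_polynomial _.
  have e1 : 1 <= eta^-1 by rewrite invr_ge1 ?unitf_gt0.
  have ge : eta^-1 <= gam 1%N ^- 2.
    rewrite lef_pV2 ?posrE ?exprn_gt0 //; apply: le_trans (gam_le 1%N).
    by rewrite expr2 ler_piMr // ltW.
  have : C0 * (1 + eta^-1) <= C0 * (2 * gam 1%N ^- 2) by rewrite ler_pM2l //; lra.
  have : C0 * (2 * gam 1%N ^- 2) <= C0 * (2 * gam 1%N ^- 2) * A.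
    by apply: ler_peMr => //; rewrite mulr_ge0 ?mulr_ge0 ?invr_ge0 ?exprn_ge0 ?ltW.
  lra.
set m := ((n + 3) %/ 4)%N; pose p := (n - 2 * m + 1)%N.
have [m0 p0 pn pmn pm8] := ceil4_split n1; rewrite -/m -/p in m0 p0 pn pmn pm8.
have mR : 0 < m%:R :> R by rewrite ltr0n.
have pR : 0 < p%:R :> R by rewrite ltr0n.
have nR : 0 < n%:R :> R by rewrite ltr0n.
have pm : n%:R ^+ 2 / 8 <= p%:R * m%:R :> R.
  by rewrite ler_pdivrMr // expr2 -!natrM ler_nat.
have qp : ((p + 3) %/ 4 <= m)%N by rewrite leq_div2r // leq_add2r ltnW.
clearbody m p.
pose D := C0 * m%:R `^ (- alpha).
have D0 : 0 < D by rewrite mulr_gt0 ?powR_gt0.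
have IHp := IH p pn p0 (good_le (ltnW pn) gn).
have sq : (gam n * tau n) ^+ 2 <= 4 * m%:R * tau p * D.
  have mm : (0 < m + m)%N by rewrite addn_gt0 m0.
  have := estimate p0 mm pmn gn D0 (kw_le m0).
  rewrite addnn -mul2n natrM mulrA exprM -!exprMn ler_pXn2r ?nnegrE ?sqr_ge0 //.
  - by rewrite -natrM.
  - by rewrite muln_gt0.
  - by rewrite !mulr_ge0 // ltW.
have tp : tau p <= C0 * (2 * A) * (2 * m%:R) * gam n ^- 2 * p%:R `^ (- alpha).
  apply: le_trans IHp _; apply: ler_wpM2r; first exact: powR_ge0.
  apply: ler_pM.
  - by rewrite !mulr_ge0 // ltW.
  - by rewrite invr_ge0 exprn_ge0 ?ltW.
  - apply: ler_wpM2l; first by rewrite !mulr_ge0 // ltW.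
    by apply: ler_wpM2l => //; rewrite ler_nat.
  - rewrite lef_pV2 ?posrE ?exprn_gt0 // ler_sqr ?nnegrE ?(ltW (gam_gt0 _)) //.
    exact: (gam_nincr p0 (ltnW pn) gn).
have pmA : p%:R `^ (- alpha) * m%:R `^ (- alpha) <= A * (n%:R `^ (- alpha)) ^+ 2.
  rewrite -powRM ?ler0n //.
  have n8 : 0 < n%:R ^+ 2 / 8 :> R by rewrite divr_gt0 ?exprn_gt0.
  apply: le_trans (powRN_le (ltW alpha_gt0) n8 pm) _.
  rewrite powRM ?exprn_ge0 ?invr_ge0 //.
  rewrite mulrC -powR_inv1 // -powRrM mulrNN mul1r -/A.
  by rewrite expr2 powRM ?ler0n // -expr2.
rewrite -(ler_pM2l g0) -ler_sqr ?nnegrE; last first.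
- by rewrite !mulr_ge0 ?powR_ge0 ?invr_ge0 ?exprn_ge0 ?ltW.
- by rewrite mulr_ge0 // ltW.
apply: le_trans sq _.
set P := p%:R `^ _ in tp pmA; set M := m%:R `^ _ in pmA D D0 *.
set Q := n%:R `^ (- alpha) in pmA *.
(* The claimed bound is a fixed point: inserting it for [tau p] returns its own square, once [P * M]
   is replaced by [A * Q ^+ 2]. *)
have -> : (gam n * (C0 * (2 * A) * (2 * m%:R) * gam n ^- 2 * Q)) ^+ 2 =
    16 * m%:R ^+ 2 * C0 ^+ 2 * gam n ^- 2 * A * (A * Q ^+ 2).
  by field; rewrite gt_eqF.
apply: (@le_trans _ _ (4 * m%:R * (C0 * (2 * A) * (2 * m%:R) * gam n ^- 2 * P) * D)).
  by apply: ler_wpM2r; [exact: ltW|apply: ler_wpM2l => //; rewrite mulr_ge0 ?ltW].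
have -> : 4 * m%:R * (C0 * (2 * A) * (2 * m%:R) * gam n ^- 2 * P) * D =
    16 * m%:R ^+ 2 * C0 ^+ 2 * gam n ^- 2 * A * (P * M).
  by rewrite /D; ring.
apply: ler_wpM2l => //.
by rewrite !mulr_ge0 ?invr_ge0 ?exprn_ge0 ?ltW.
Qed.

Section Refined.
Variables (Cz zeta beta : R).
Hypotheses (zeta_gt0 : 0 < zeta) (beta_gt : 1 / 2 < beta).
Hypothesis gam_inv_le : forall n, (0 < n)%N -> good n ->
  (gam n)^-1 <= Cz * n%:R `^ zeta.
Let theta := zeta + beta.
(** The largest ratio m/K for which a decay n^(theta - alpha) reproduces itself: comparing exponents
    requires zeta + 1/2 <= theta (1 - m/K). *)
Let d0 := (beta - 1 / 2) / theta.
Let C1 := C1_cst C0 alpha Cz zeta beta.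

Let theta_gt0 : 0 < theta.
Proof. by have := beta_gt; rewrite /theta; move: zeta_gt0; lra. Qed.
Let d0_gt0 : 0 < d0.
Proof. by rewrite divr_gt0 // subr_gt0. Qed.

Lemma C1_cst_ge1 : 1 <= C1.
Proof.
rewrite /C1 /C1_cst big_ltn ?addn1 // mulr1n powR1 2!le_max.
by rewrite lexx orbT.
Qed.

Lemma ln_C1_cst_ge : 0 < Cz ->
  ln C0 + 2 * alpha ^+ 2 / zeta * ln 2 - alpha * ln d0 + theta / zeta * ln Cz
    <= ln C1.
Proof.
move=> Cz0; pose B := C0 * 2 `^ (2 * alpha ^+ 2 / zeta)
      * (theta / (beta - 1 / 2)) `^ alpha * Cz `^ (theta / zeta).
have td0 : theta / (beta - 1 / 2) = d0^-1 by rewrite /d0 invf_div.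
move: td0 d0_gt0; move: d0 => d td0 d_gt0.
have B0 : 0 < B.
  by rewrite !mulr_gt0 ?powR_gt0 // td0 invr_gt0.
have <- : ln B = ln C0 + 2 * alpha ^+ 2 / zeta * ln 2 - alpha * ln d
    + theta / zeta * ln Cz.
  rewrite /B td0 3?lnM ?posrE ?mulr_gt0 ?powR_gt0 ?invr_gt0 //.
  by rewrite 3!ln_powR lnV ?posrE // mulrN.
rewrite ler_ln ?posrE //; last exact: lt_le_trans C1_cst_ge1.
rewrite le_max; apply/orP; left; apply: ler_wpM2l.
  by rewrite !mulr_ge0 ?powR_ge0 // ltW.
by rewrite le_max lexx orbT.
Qed.

(* As [tau n <= 1 <= C1], only [theta < alpha] matters; then the estimate on
   the [K] indices from [uphalf n] to [n], with [m = truncn (d0 * K)],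
   propagates the bound. When [m = 0], [n] is below about [2 / d0] and [tau 1]
   is already small enough. *)
Lemma tau_refined n : (0 < n)%N -> good n ->
  tau n <= C1 * n%:R `^ (theta - alpha).
Proof.
have [eta0 eta1] := andP eta01.
have lnC1_ge := ln_C1_cst_ge; have d_gt0 := d0_gt0.
have d1 : d0 < 1 by rewrite ltr_pdivrMr // mul1r /theta; move: zeta_gt0; lra.
have dth : d0 * theta = beta - 1 / 2 by rewrite /d0 divfK // gt_eqF.
move: d0 lnC1_ge d_gt0 d1 dth => d lnC1_ge d_gt0 d1 dth.
have C1_1 := C1_cst_ge1; have C1_0 : 0 < C1 := lt_le_trans ltr01 C1_1.
have [at_|ta] := leP alpha theta.
  move=> n0 _; apply: le_trans (tau_le1 n) _; apply: mulr_ege1 => //.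
  have n1 : 1 <= n%:R :> R by rewrite ler1n.
  have at0 : 0 <= theta - alpha by rewrite subr_ge0.
  by have := ler_powR n1 at0; rewrite powRr0.
elim/ltn_ind: n => n IH n0 gn.
have [n1|n1] := leqP n 1%N.
  have -> : n = 1%N by apply/eqP; rewrite eqn_leq n1.
  by rewrite mulr1n powR1 mulr1 (le_trans (tau_le1 _)).
have nR : 0 < n%:R :> R by rewrite ltr0n.
have nR1 : 1 <= n%:R :> R by rewrite ler1n.
have [t0|t0] := leP (tau n) 0.
  by apply: le_trans t0 _; rewrite mulr_ge0 ?powR_ge0 // ltW.
have g1 := good_le n0 gn.
have e1 : 1 <= eta^-1 by rewrite invr_ge1 ?unitf_gt0.
have Cz_eta : eta^-1 <= Cz.
  have := gam_inv_le (ltn0Sn 0) g1; rewrite mulr1n powR1 mulr1; apply: le_trans.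
  by rewrite lef_pV2 ?posrE.
have Cz1 : 1 <= Cz := le_trans e1 Cz_eta.
have Cz0 : 0 < Cz := lt_le_trans ltr01 Cz1.
have lnC1 := lnC1_ge Cz0.
have ln2_ge0 : 0 <= ln 2 :> R by rewrite ln_ge0 // ler1n.
have lnn_ge0 := ln_ge0 nR1; have lnCz_ge0 := ln_ge0 Cz1.
rewrite -ler_ln ?posrE //; last by rewrite mulr_gt0 ?powR_gt0.
rewrite lnM ?posrE ?powR_gt0 // ln_powR.
have := uphalf_split n1.
move: (uphalf n) (n./2.+1) => p K [p0 pn pK Kn [K0 n2K n2p]].
have KR : 0 < K%:R :> R by rewrite ltr0n.
have n2KR : n%:R <= 2 * K%:R :> R by rewrite -natrM ler_nat.
have /andP[mle mgt] := truncn_itv (mulr_ge0 (ltW d_gt0) (ltW KR)).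
move: (Num.truncn _) mle mgt => m mle mgt.
have [m0|m0] := posnP m.
  apply: log_rate_base zeta_gt0 beta_gt erefl ta ln2_ge0 lnn_ge0 lnCz_ge0 _ lnC1 _.
    have dn : d * n%:R * 2^-1 <= 1.
      move: mgt; rewrite m0 => /ltW; apply: le_trans; rewrite -mulrA.
      by rewrite ler_pM2l // ler_pdivrMr // mulrC.
    have := ln_le0 dn; rewrite !lnM ?posrE ?mulr_gt0 ?invr_gt0 //.
    by rewrite lnV ?posrE.
  have -> : 2 * ln 2 + ln C0 + ln Cz = ln (2 * 2 * C0 * Cz) :> R.
    by rewrite !lnM ?posrE ?mulr_gt0 //; lra.
  rewrite ler_ln ?posrE ?mulr_gt0 //.
  apply: le_trans (tau_nincr n0) _; apply: le_trans tau1_polynomial _.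
  have : (1 + eta^-1) * C0 <= 2 * Cz * C0 by rewrite ler_pM2r //; lra.
  lra.
have mK : (m < K)%N.
  rewrite -(ltr_nat R); apply: le_lt_trans mle _.
  by rewrite -[ltRHS]mul1r ltr_pM2r.
have mrK : (m + (K - m) = K)%N by rewrite subnKC // ltnW.
have mR : 0 < m%:R :> R by rewrite ltr0n.
have pR : 0 < p%:R :> R by rewrite ltr0n.
have KE : K%:R = m%:R + (K - m)%:R :> R by rewrite -natrD mrK.
have rR : 0 < (K - m)%:R :> R by rewrite ltr0n subn_gt0.
have tp0 : 0 < tau p := lt_le_trans t0 (tau_nincr (ltnW pn)).
have D0 : 0 < C0 * m%:R `^ (- alpha) by rewrite mulr_gt0 ?powR_gt0.
have est := @estimate p m (K - m)%N n (C0 * m%:R `^ (- alpha)) p0.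
rewrite mrK in est; have {}est := est K0 pK gn D0 (kw_le m0).
have g0 := gam_gt0 n.
apply: (@log_rate_step R K%:R m%:R (K - m)%:R alpha zeta beta theta (ln 2)
  (ln n%:R) (ln Cz) (ln K%:R) (ln m%:R) (ln p%:R) (ln d) (ln C0) (ln C1)
  (ln (gam n)) (ln (tau n)) (ln (tau p))) => //.
- have : d * K%:R * theta = (beta - 1 / 2) * K%:R by rewrite mulrAC dth.
  have : m%:R * theta <= d * K%:R * theta by rewrite ler_pM2r.
  rewrite KE /theta; lra.
- by rewrite ler_ln ?posrE // ler_nat.
- rewrite -ln_div ?posrE // ler_ln ?posrE ?divr_gt0 //.
  by rewrite ler_pdivrMr // mulrC -natrM ler_nat.
(* As m >= 1, d K < m + 1 <= 2m; with n <= 2K this gives d n <= 4m. *)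
- have -> : ln d + ln n%:R - 2 * ln 2 = ln (d * n%:R / (2 * 2)) :> R.
    by rewrite ln_div ?posrE ?mulr_gt0 // !lnM ?posrE //; lra.
  rewrite ler_ln ?posrE ?divr_gt0 ?mulr_gt0 // ler_pdivrMr ?mulr_gt0 //.
  have : d * n%:R <= d * (2 * K%:R) by rewrite ler_pM2l.
  have : 1 <= m%:R :> R by rewrite ler1n.
  move: mgt; rewrite -addn1 natrD; lra.
- have := gam_inv_le n0 gn.
  rewrite -ler_ln ?posrE ?invr_gt0 ?mulr_gt0 ?powR_gt0 //.
  rewrite lnV ?posrE // lnM ?posrE ?powR_gt0 // ln_powR; lra.
- have := IH p pn p0 (good_le (ltnW pn) gn).
  rewrite -ler_ln ?posrE ?mulr_gt0 ?powR_gt0 //.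
  by rewrite lnM ?posrE ?powR_gt0 // ln_powR.
have lnX (x : R) k : 0 < x -> ln (x ^+ k) = k%:R * ln x.
  by move=> x0; rewrite lnXn // mulr_natl.
set D := C0 * _ in D0 est.
have lnD : ln D = ln C0 - alpha * ln m%:R.
  by rewrite lnM ?posrE ?powR_gt0 // ln_powR mulNr.
have gt0 : 0 < gam n * tau n by rewrite mulr_gt0.
have KK0 : 0 < 2 * K%:R :> R by rewrite mulr_gt0.
rewrite -lnD -(lnM (x := gam n)) ?posrE // -(lnM (x := 2)) ?posrE //.
clearbody D; clear lnD; move: est; rewrite -ler_ln ?posrE ?mulr_gt0 ?exprn_gt0 //.
rewrite [ln (_ * D ^+ _)]lnM ?posrE ?mulr_gt0 ?exprn_gt0 //.
rewrite [ln (_ ^+ K * _)]lnM ?posrE ?exprn_gt0 //.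
by rewrite !lnX // !natrM.
Qed.

End Refined.

End Polynomial.

Section Exponential.
Variable c1 : R.
Hypotheses (c1_gt0 : 0 < c1) (C0_ge1 : 1 <= C0).
Hypothesis kw_le : forall n, (0 < n)%N ->
  kw n <= C0 * expR (- (c1 * n%:R `^ alpha)).

Lemma tau1_exponential : tau 1%N <= 2 * (1 + eta^-1) * C0.
Proof.
apply: tau1 => //; apply: le_trans (kw_le (ltn0Sn 0)) _.
rewrite ler_piMr ?(ltW C0_gt0) // -[leRHS]expR0 ler_expR oppr_le0.
by rewrite mulr_ge0 ?powR_ge0 // ltW.
Qed.

(** With p = 1, K = n and m = n/2 rounded down, bounding [tau 1] by 1 avoids any induction: the
    estimate becomes (gamma_n tau_n)^2 <= 2n D, where D bounds the width. *)
Lemma tau_exponential n : (1 < n)%N -> good n ->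
  tau n <= C0 * Num.sqrt 2 * (gam n)^-1 * Num.sqrt n%:R
    * expR (- (c1 * 2 `^ (- (2 * alpha) - 1) * n%:R `^ alpha)).
Proof.
move=> n1 gn; have [eta0 eta1] := andP eta01; have g0 := gam_gt0 n.
set E := expR _; set T := _ * E.
have E0 : 0 < E by exact: expR_gt0.
have T0 : 0 <= T by rewrite !mulr_ge0 ?sqrtr_ge0 ?invr_ge0 // ltW.
have := half_split n1; move: (n./2) => m [m0 mr m2 m4].
pose D := C0 * expR (- (c1 * m%:R `^ alpha)).
have D0 : 0 < D by rewrite mulr_gt0 ?expR_gt0.
(* Two facts combine: m >= n/4, and C0 <= C0^2, which is where C0 >= 1 enters. *)
have DE : D <= (C0 * E) ^+ 2.
  rewrite exprMn expr2 -mulrA; apply: ler_wpM2l; first exact: ltW.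
  apply: (@le_trans _ _ (E ^+ 2)).
    rewrite expr2 -expRD ler_expR -opprD lerN2 -mulr2n -mulrnAl -mulrnAr.
    rewrite -mulrA; apply: ler_wpM2l; first exact: ltW.
    rewrite powR2_quarter.
    rewrite -powRM ?invr_ge0 //; apply: (ge0_ler_powR (ltW alpha_gt0)).
    - by rewrite nnegrE mulr_ge0 ?invr_ge0.
    - by rewrite nnegrE.
    by rewrite ler_pdivrMl // -natrM ler_nat.
  exact: ler_peMl (sqr_ge0 E) C0_ge1.
have T2 : T ^+ 2 = 2 * n%:R * gam n ^- 2 * (C0 * E) ^+ 2.
  rewrite /T !exprMn !sqr_sqrtr ?exprVn //; ring.
have TD : 2 * n%:R * gam n ^- 2 * D <= T ^+ 2.
  by rewrite T2; apply: ler_wpM2l => //; rewrite !mulr_ge0 // invr_ge0 exprn_ge0 // ltW.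
clear T2 DE; clearbody T.
(* Lowering the power of D from 2(n - m) to n requires D <= 1; for larger D the target already
   exceeds 1. *)
have [D1|D1] := leP 1 D.
  apply: le_trans (tau_le1 n) _; rewrite -ler_sqr ?nnegrE ?ler01 ?T0 //.
  rewrite expr1n; apply: le_trans TD; rewrite -mulrA.
  have gi : 1 <= gam n ^- 2.
    by rewrite -exprVn exprn_ege1 // invr_ge1 ?unitf_gt0 // (le_trans (gam_le n)).
  have nR : 1 <= n%:R :> R by rewrite ler1n ltnW.
  apply: mulr_ege1; first by lra.
  exact: mulr_ege1.
rewrite -ler_sqr ?nnegrE ?tau_ge0 ?T0 //; apply: le_trans TD.
have -> : 2 * n%:R * gam n ^- 2 * D = gam n ^- 2 * (2 * n%:R * D) by ring.
rewrite ler_pdivlMl; last exact: exprn_gt0.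
rewrite -exprMn.
have := @estimate 1%N m (n - m)%N n D; rewrite mr => /(_ isT).
have n0 : (0 < n)%N by exact: ltnW.
rewrite add1n => /(_ n0 erefl gn D0 (kw_le m0)) est.
rewrite -(ler_pXn2r n0) ?nnegrE ?sqr_ge0 //; last first.
  by rewrite mulr_ge0 ?(ltW D0) // mulr_ge0.
rewrite -exprM; apply: le_trans est _.
rewrite [leRHS]exprMn -[leLHS]mulrA; apply: ler_wpM2l; first by rewrite exprn_ge0 // mulr_ge0.
apply: (@le_trans _ _ (D ^+ (2 * (n - m)))).
  apply: ler_piMl; first by rewrite exprn_ge0 // ltW.
  by rewrite exprn_ile1.
by apply: ler_wiXn2l => //; exact: ltW.
Qed.

End Exponential.
End Rates.

Unset Implicit Arguments.

Theorem corollary4p13 (R : realType) (X : completeNormedModType R)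
  (N : option nat) (F : set X) (Sigma : set {linear X -> R^o}) (eta : R)
  (Fn : nat -> set X) (Sigman : nat -> set {linear X -> R^o})
  (phi : nat -> X) (sigma : nat -> {linear X -> R^o})
  (hset : geim_setting N F Sigma)
  (hgreedy : geim_weak_greedy N F Sigma eta Fn Sigman phi sigma)
  (C0 alpha c1 : R) (hC0 : 0 < C0) (halpha : 0 < alpha) (hc1 : 0 < c1)
  (hmono : forall m n : nat, (1 <= m)%N -> (m <= n)%N -> leN n N ->
     lebesgue_cst phi sigma m <= lebesgue_cst phi sigma n) :
  [/\ (* (i) *)
      (forall n : nat, (1 <= n)%N -> kwidth F n <= C0 * n%:R `^ (- alpha)) ->
      forall (u : X) (n : nat), F u -> (1 <= n)%N -> leN n N ->
        `|u - geim_op phi sigma n u| <=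
          if n == 1%N then
            2 * C0 * (1 + eta^-1) * (1 + lebesgue_cst phi sigma 1)
          else
            C0 * 2 `^ (3 * alpha + 1) * ell2 R n
              * (1 + lebesgue_cst phi sigma n) ^+ 3 * eta ^- 2
              * n%:R `^ (- alpha),
      (* (ii) *)
      1 <= C0 ->
      (forall n : nat, (1 <= n)%N ->
         kwidth F n <= C0 * expR (- (c1 * n%:R `^ alpha))) ->
      let c2 := c1 * 2 `^ (- (2 * alpha) - 1) in
      forall (u : X) (n : nat), F u -> (1 <= n)%N -> leN n N ->
        `|u - geim_op phi sigma n u| <=
          if n == 1%N then
            2 * C0 * (1 + eta^-1) * (1 + lebesgue_cst phi sigma 1)
          else
            C0 * Num.sqrt 2 * (1 + lebesgue_cst phi sigma n) ^+ 2 * eta^-1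
              * Num.sqrt n%:R * expR (- (c2 * n%:R `^ alpha))
    & (* (iii) *)
      forall Czeta zeta : R, 0 < Czeta -> 0 < zeta ->
      (forall n : nat, (1 <= n)%N -> kwidth F n <= C0 * n%:R `^ (- alpha)) ->
      (forall n : nat, (1 <= n)%N -> leN n N ->
         (geim_gamma eta phi sigma n)^-1 <= Czeta * n%:R `^ zeta) ->
      forall beta : R, 1 / 2 < beta ->
      forall (u : X) (n : nat), F u -> (1 <= n)%N -> leN n N ->
        `|u - geim_op phi sigma n u| <=
          eta * Czeta * C1_cst C0 alpha Czeta zeta beta
            * n%:R `^ (- alpha + 2 * zeta + beta)].

Proof.
have eta01 := geim_eta hgreedy; have [eta0 eta1] := andP eta01.
have F1 := geim_le1 hset; have F0 := geim_F_neq0 hset hgreedy.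
have N0 : leN 0 N := leN_trans (leq0n 1) (geim_N_ge1 hset).
pose L := lebesgue_cst phi sigma; pose tau := greedy_width F phi.
pose gam := geim_gamma eta phi sigma.
have L0 n : 0 <= L n by exact: geim_lebesgue_ge0.
have L1 n : 0 < 1 + L n by rewrite ltr_pwDl.
have gam_gt0 n : 0 < gam n by rewrite divr_gt0.
have gam_le n : gam n <= eta by rewrite ler_pdivrMr // ler_peMr ?lerDl // ltW.
have gam_nincr m n : (0 < m)%N -> (m <= n)%N -> leN n N -> gam n <= gam m.
  move=> m0 mn nN; rewrite /gam /geim_gamma ler_pM2l // lef_pV2 ?posrE //.
  by rewrite lerD2l hmono.
have goodW m n : (m <= n)%N -> leN n N -> leN m N by exact: leN_trans.
have tau_nincr m n : (m <= n)%N -> tau n <= tau m by exact: greedy_width_nincr.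
have tau_ge0 n : 0 <= tau n by exact: greedy_width_ge0.
have tau_le1 n : tau n <= 1 by exact: greedy_width_le1.
have tau1 D : 0 < D -> kwidth F 1 <= D -> tau 1%N <= 2 * (1 + eta^-1) * D.
  apply: greedy_width1_le => //; first exact: (geim_phi_F hgreedy N0).
  by move=> u; apply: (geim_phi0_weak hset hgreedy).
have estimate p m r n D : (0 < p)%N -> (0 < m + r)%N ->
    (p + (m + r) = n.+1)%N -> leN n N -> 0 < D -> kwidth F m <= D ->
    (gam n * tau n) ^+ (2 * (m + r))
      <= (2 * (m + r)%:R) ^+ (m + r) * tau p ^+ (2 * m) * D ^+ (2 * r).
  move=> p0 mr pn nN D0 FD; apply: weak_greedy_estimate => // [|i|i].
  - exact: ltW.
  - by move=> /andP[_ /goodW/(_ nN)]; apply: (geim_phi_F hgreedy).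
  (* By monotonicity of the Lebesgue constants, the constant at [n] is the smallest among the
     indices from [p] to [n], all at least 1. *)
  - move=> /andP[pi ni]; have iN := goodW _ _ ni nN.
    apply: le_trans (geim_phi_weak_greedy hset hgreedy iN).
    by apply: ler_wpM2r => //; apply: gam_nincr => //; apply: leq_trans pi.
have gamV n : (gam n)^-1 = (1 + L n) / eta by rewrite invf_div.
have error u n T : F u -> leN n N -> tau n <= T ->
    `|u - geim_op phi sigma n u| <= (1 + L n) * T.
  move=> Fu nN nT; apply: le_trans (geim_error_le hset hgreedy nN Fu) _.
  by rewrite ler_pM2l.
split.
- move=> kw_le u n Fu n0 nN; case: eqP => [n1|/eqP n1].
    subst n; apply: le_trans (error _ _ _ Fu nN (tau1_polynomial tau1 hC0 kw_le)) _.
    by rewrite mulrC (mulrAC 2).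
  have := tau_polynomial eta01 goodW tau_ge0 tau1 gam_gt0 gam_le gam_nincr
    estimate hC0 halpha kw_le n0 nN.
  move=> /(error u n _ Fu nN)/le_trans; apply.
  rewrite ell2E -exprVn gamV expr_div_n -/(L n) le_eqVlt; apply/orP; left.
  by apply/eqP; ring.
- move=> C01 kw_le c2 u n Fu n0 nN; case: eqP => [n1|/eqP n1].
    subst n; apply: le_trans
      (error _ _ _ Fu nN (tau1_exponential tau1 hC0 hc1 kw_le)) _.
    by rewrite mulrC (mulrAC 2).
  have n2 : (1 < n)%N by rewrite ltn_neqAle eq_sym n1.
  have := tau_exponential eta01 tau_ge0 tau_le1 gam_gt0 gam_le
    estimate hC0 halpha hc1 C01 kw_le n2 nN.
  move=> /(error u n _ Fu nN)/le_trans; apply.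
  rewrite gamV -/(L n) -/c2 le_eqVlt; apply/orP; left.
  by apply/eqP; ring.
- move=> Cz zeta Cz0 zeta0 kw_le gam_inv beta beta12 u n Fu n0 nN.
  have := tau_refined eta01 goodW tau_le1 tau_nincr tau1 gam_gt0 gam_le
    estimate hC0 kw_le zeta0 beta12 gam_inv n0 nN.
  move=> tn; apply: le_trans (error u n _ Fu nN tn) _.
  set C1 := C1_cst _ _ _ _ _.
  have C1_0 : 0 <= C1 := le_trans ler01 (C1_cst_ge1 _ _ _ _ _).
  have -> : - alpha + 2 * zeta + beta = zeta + (zeta + beta - alpha) by ring.
  rewrite [_ `^ (zeta + (_ - _))]powRD; last by rewrite pnatr_eq0 -lt0n n0 implybT.
  (* The factor from [tau n] to the error is eta / gamma_n: it supplies [eta * Cz] and the second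
     [zeta] of the exponent. *)
  have LE : 1 + L n = eta * (gam n)^-1 by rewrite gamV mulrC divfK ?gt_eqF.
  have LC : 1 + L n <= eta * (Cz * n%:R `^ zeta).
    by rewrite LE ler_pM2l //; apply: gam_inv.
  set P := n%:R `^ (zeta + beta - alpha).
  have P0 : 0 <= C1 * P by rewrite mulr_ge0 // powR_ge0.
  apply: le_trans (ler_wpM2r P0 LC) _; rewrite le_eqVlt; apply/orP; left.
  by apply/eqP; ring.
Qed.
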